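(* Let $T\subset[0,\infty)$ be locally finite. Then $T\in\mathfrak U_{\mathrm{com}}$ if and only if $0\in T$ and $N_T(R)\asymp R$ as $R\to\infty$.
   Context: $\mathbb N=\{0,1,2,\dots\}$. A set $T\subset[0,\infty)$ is locally finite if $T\cap[0,R]$ is finite for every $R>0$; $N_T(R)=\#(T\cap[0,R])$. The notation $N_T(R)\asymp R$ as $R\to\infty$ means that there are $0<c\le c'<\infty$ and $R_0>0$ with $cR\le N_T(R)\le c'R$ for $R\ge R_0$. For a positive operator $A$ on a Hilbert space, $A^t$ is defined by continuous functional calculus for $t>0$ and $A^0=I$. The family $\{CA^t\}_{t\in T}$ is exactly observable if there are $0<a\le b<\infty$ with $a\|x\|^2\le\sum_{t\in T}\|CA^tx\|^2\le b\|x\|^2$ for all $x\in H$. $\mathfrak U_{\mathrm{com}}$ is the class of locally finite sets $T\subset[0,\infty)$ such that for all separable complex Hilbert spaces $H,Y$, every positive $A\in\mathcal B(H)$ and every $C\in\mathcal B(H,Y)$ satisfying $[A,C^*C]=AC^*C-C^*CA=0$, exact observability of $\{CA^n\}_{n\in\mathbb N}$ implies exact observability of $\{CA^t\}_{t\in T}$. *)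

(* Defs.v *)
From HB Require Import structures.
From mathcomp Require Import all_boot all_order all_algebra.
From mathcomp Require Import finmap complex.
From mathcomp Require Import all_classical all_reals all_analysis.

Set Implicit Arguments.
Unset Strict Implicit.
Unset Printing Implicit Defensive.

Import Order.TTheory GRing.Theory Num.Theory numFieldNormedType.Exports.

Local Open Scope classical_set_scope.
Local Open Scope ring_scope.
Local Open Scope complex_scope.

(* Complex Hilbert spaces. As in MathComp's sesquilinear forms, the inner
   product is linear in its first argument. The zero space is allowed. *)
HB.mixin Record CompleteNormedModule_isHilbert (R : realType) (H : Type)
    of CompleteNormedModule R[i] H := {
  inner : {dot H for Num.conj} ;
  normr_inner : forall x : H, `|x| ^+ 2 = inner x x
}.

#[short(type="hilbertType")]
HB.structure Definition Hilbert (R : realType) :=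
  {H of CompleteNormedModule R[i] H & CompleteNormedModule_isHilbert R H}.

(* The norm of a normedModType R[i] has values in R[i] (they are real and
   nonnegative); hnorm is the same norm with values in R. *)
Definition hnorm (R : realType) (H : hilbertType R) (x : H) : R :=
  complex.Re `|x|.

Definition separable_space (T : topologicalType) : Prop :=
  exists2 D : set T, countable D & dense D.

Section operators.
Context {R : realType}.

Definition bounded_op (H Y : hilbertType R) : set (H -> Y) :=
  [set B | linear B /\ exists M : R, forall x, hnorm (B x) <= M * hnorm x].

Definition is_adjoint (H Y : hilbertType R) (B : H -> Y) (D : Y -> H) : Prop :=
  forall x y, inner (B x) y = inner x (D y).

(* For bounded B the adjoint exists (Riesz) and is unique. *)
Definition adjoint (H Y : hilbertType R) (B : H -> Y) : Y -> H :=
  xget (fun=> 0) [set D | is_adjoint B D].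

(* The order of R[i] is the one for which 0 <= z means that z is real and
   nonnegative. *)
Definition positive_op (H : hilbertType R) (A : H -> H) : Prop :=
  forall x, 0 <= inner (A x) x.

Definition spectrum (H : hilbertType R) (A : H -> H) : set R[i] :=
  [set z | ~ exists B : H -> H,
     [/\ bounded_op B,
         forall x, B (A x - z *: x) = x &
         forall x, A (B x) - z *: B x = x]].

(* C(S): elements are represented by total functions, of which only the
   restriction to S is relevant. *)
Definition continuous_on (S : set R[i]) : set (R[i] -> R[i]) :=
  [set f | {within (S : set R[i]^o), continuous (f : R[i]^o -> R[i]^o)}].

(* Phi is the continuous functional calculus of A: a unital *-homomorphism
   from C(spectrum A) to the bounded operators that maps the identity
   function to A. For a bounded normal A there is exactly one such Phi on
   C(spectrum A). *)
Record is_continuous_calculus (H : hilbertType R) (A : H -> H)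
    (Phi : (R[i] -> R[i]) -> H -> H) : Prop := {
  calculus_bounded : forall f, continuous_on (spectrum A) f ->
    bounded_op (Phi f) ;
  calculus_restrict : forall f g,
    continuous_on (spectrum A) f -> continuous_on (spectrum A) g ->
    (forall z, spectrum A z -> f z = g z) -> Phi f = Phi g ;
  calculusD : forall f g,
    continuous_on (spectrum A) f -> continuous_on (spectrum A) g ->
    forall x, Phi (fun z => f z + g z) x = Phi f x + Phi g x ;
  calculusZ : forall (c : R[i]) f, continuous_on (spectrum A) f ->
    forall x, Phi (fun z => c * f z) x = c *: Phi f x ;
  calculusM : forall f g,
    continuous_on (spectrum A) f -> continuous_on (spectrum A) g ->
    forall x, Phi (fun z => f z * g z) x = Phi f (Phi g x) ;
  calculus_adjoint : forall f, continuous_on (spectrum A) f ->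
    is_adjoint (Phi f) (Phi (fun z => Num.conj (f z))) ;
  calculus1 : forall x, Phi (fun=> 1) x = x ;
  calculus_id : forall x, Phi (fun z => z) x = A x
}.

Definition continuous_calculus (H : hilbertType R) (A : H -> H) :
    (R[i] -> R[i]) -> H -> H :=
  xget (fun _ _ => 0) [set Phi | is_continuous_calculus A Phi].

(* A^t for a positive bounded A. Its spectrum lies in [0, +oo[, so there
   z = Re z, and the function below is z |-> z^t. *)
Definition op_power (H : hilbertType R) (A : H -> H) (t : R) : H -> H :=
  if t == 0 then idfun
  else continuous_calculus A (fun z => (complex.Re z `^ t)%:C).

Definition exactly_observable (H Y : hilbertType R) (I : choiceType)
    (D : set I) (F : I -> H -> Y) : Prop :=
  exists a b : R, [/\ 0 < a, a <= b & forall x : H,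
    ((a * hnorm x ^+ 2)%:E <= \esum_(i in D) (hnorm (F i x) ^+ 2)%:E
                           <= (b * hnorm x ^+ 2)%:E)%E].

Definition locally_finite (T : set R) : Prop :=
  forall r : R, 0 < r -> finite_set (T `&` `[0, r]).

Definition counting_function (T : set R) (r : R) : nat :=
  #|` fset_set (T `&` `[0, r])|.

Definition linear_growth (T : set R) : Prop :=
  exists c c' r0 : R, [/\ 0 < c, c <= c', 0 < r0 & forall r : R, r0 <= r ->
    c * r <= (counting_function T r)%:R <= c' * r].

Definition U_com : set (set R) :=
  [set T | [/\ T `<=` `[0, +oo[, locally_finite T &
    forall (H Y : hilbertType R) (A : H -> H) (C : H -> Y),
      separable_space H -> separable_space Y ->
      bounded_op A -> positive_op A -> bounded_op C ->
      (forall x, A (adjoint C (C x)) - adjoint C (C (A x)) = 0) ->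
      exactly_observable [set: nat] (fun n x => C (iter n A x)) ->
      exactly_observable T (fun t x => C (op_power A t x))]].

End operators.

(* Main.v *)
(* Put [h x y = <C x, C y>]. Commutation gives [h (A x) y = h x (A y)], so the
   functional calculus turns a pointwise inequality [f <= g] on the spectrum of
   [A] into [h (f A x) x <= h (g A x) x]. Observability of [C A^n] makes [A^n]
   uniformly bounded, so the spectrum lies in [0, 1], and everything reduces to
   comparing [sum_(t in T) r^(2t)] with [sum_n r^(2n)] for [0 <= r <= 1]. With
   linear growth this is done term by term: the j-th point of [T] is of order
   [j], and [0 \in T] takes care of [r = 0].
   Conversely, let [A] be diagonal on [l^2] with eigenvalues [0] and
   [exp (- 1 / k)], and [C = sqrt (1 - A^2)], so that [sum_n |C A^n x|^2 = |x|^2].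
   On the basis vectors, observability of [C A^t] says that [0 \in T] and that
   [sum_(t in T) exp (- 2 t / k)] is of order [k], whence the linear growth. *)
From HB Require Import structures.
Require Import Defs.
From mathcomp Require Import all_boot all_order all_algebra.
From mathcomp Require Import finmap complex.
From mathcomp Require Import all_classical all_reals all_analysis.
From mathcomp Require Import ring lra.

Set Implicit Arguments.
Unset Strict Implicit.
Unset Printing Implicit Defensive.

Import Order.TTheory GRing.Theory Num.Theory numFieldNormedType.Exports.
Import ComplexField.Normc.

Local Open Scope classical_set_scope.
Local Open Scope ring_scope.
Local Open Scope complex_scope.

(** * Hilbert spaces *)

(** [op_power] goes through [continuous_calculus], which [xget] picks among all maps satisfying
    [is_continuous_calculus]. A calculus must therefore be constructed to know that one exists, but
    everything used afterwards has to follow from the axioms for an arbitrary one. No spectral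
    measure enters: a function that is nonnegative on the spectrum is a square [g * g], and moving
    one factor across [h] gives [h (g x) (g x) >= 0]. The delicate point is the bound of the norm of
    a polynomial in [A] by its supremum on the spectrum. It rests on the fact that the bottom of the
    numerical range of a bounded self-adjoint operator is an approximate eigenvalue. In the
    converse, the eigenvalue [0] detects [0 \in T] because [powR 0 t] is [1] for [t = 0] and [0] for
    [t > 0]. The eigenvalues [exp (- 1 / k)] have gap [1 - exp (- 2 / k)] of order [1 / k]; dividing
    the bounds for one basis vector by this gap produces the order [k]. *)

Lemma le_sq_of_quadratic_ge0 (R : realType) (a b c : R) : 0 <= c ->
  (forall t, 0 <= a + 2 * b * t + c * t ^+ 2) -> b ^+ 2 <= a * c.
Proof.
move=> c0 h; have [c_eq0|c_neq0] := eqVneq c 0.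
  have [->|b0] := eqVneq b 0; first by rewrite c_eq0 expr0n mulr0.
  have := h (- (a + 1) / (2 * b)).
  have -> : a + 2 * b * (- (a + 1) / (2 * b)) + c * (- (a + 1) / (2 * b)) ^+ 2
    = -1 by rewrite c_eq0; field.
  by rewrite ler0N1.
have cgt0 : 0 < c by rewrite lt_neqAle eq_sym c_neq0.
have := h (- b / c).
have -> : a + 2 * b * (- b / c) + c * (- b / c) ^+ 2 = a - b ^+ 2 / c by field.
by rewrite subr_ge0 ler_pdivrMr.
Qed.

(** The form in which most limits are taken below: an error [K * e] with [K] fixed and [e]
    arbitrary. Testing at [e / (K + 1)] avoids a case distinction on [K = 0]. *)
Lemma ler_of_forall_mulr (R : realType) (a b K : R) : 0 <= K ->
  (forall e, 0 < e -> a <= b + K * e) -> a <= b.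
Proof.
move=> K0 h; apply/ler_addgt0Pr => e e0.
apply: le_trans (h (e / (K + 1)) _) _; first by rewrite divr_gt0 // ltr_wpDl.
rewrite lerD2l mulrCA ger_pMr // ler_pdivrMr ?mul1r ?lerDl //.
by rewrite ltr_wpDl.
Qed.

Section ComplexNumbers.
Context {R : realType}.
Implicit Types z w : R[i].

Lemma normCE z : `|z| = (normc z)%:C.
Proof. by []. Qed.

Lemma normc_ge0 z : 0 <= normc z.
Proof. by case: z => a b /=; exact: sqrtr_ge0. Qed.

Lemma normc_real (r : R) : normc r%:C = `|r|.
Proof. by rewrite /= expr0n addr0 sqrtr_sqr. Qed.

Lemma normc_conj z : normc (conjc z) = normc z.
Proof. by case: z => a b /=; rewrite sqrrN. Qed.

Lemma sqr_normcE z : ((normc z) ^+ 2)%:C = z * conjc z.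
Proof. by rewrite -sqr_normc normCE rmorphXn. Qed.

Lemma normc_sqr z : normc z ^+ 2 = complex.Re z ^+ 2 + complex.Im z ^+ 2.
Proof. by case: z => a b /=; rewrite sqr_sqrtr // addr_ge0 ?sqr_ge0. Qed.

Lemma Re_le_normc z : complex.Re z <= normc z.
Proof.
rewrite (le_trans (ler_norm _)) // -ler_sqr ?nnegrE ?normc_ge0 //.
by rewrite normc_sqr real_normK ?num_real // lerDl sqr_ge0.
Qed.

Lemma normcB z w : normc (z - w) = normc (w - z).
Proof. by rewrite -normcN opprB. Qed.

Lemma ReD z w : complex.Re (z + w) = complex.Re z + complex.Re w.
Proof. by case: z w => a b [c d]. Qed.

Lemma ReN z : complex.Re (- z) = - complex.Re z.
Proof. by case: z. Qed.

Lemma ReZ (r : R) z : complex.Re (r%:C * z) = r * complex.Re z.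
Proof. by case: z => a b /=; rewrite mul0r subr0. Qed.

Lemma ReZr z (r : R) : complex.Re (z * r%:C) = complex.Re z * r.
Proof. by rewrite mulrC ReZ mulrC. Qed.

Lemma ReJ z : complex.Re (conjc z) = complex.Re z.
Proof. by case: z. Qed.

End ComplexNumbers.

Section HilbertSpace.
Context {R : realType} {H : hilbertType R}.
Implicit Types x y u v : H.

Lemma hnormE x : `|x| = (hnorm x)%:C.
Proof. by rewrite /hnorm RRe_real // ger0_real. Qed.

Lemma hnorm_ge0 x : 0 <= hnorm x.
Proof. by rewrite -ler0c -hnormE. Qed.

Lemma hnorm0 : hnorm (0 : H) = 0.
Proof. by rewrite /hnorm normr0. Qed.

Lemma hnorm_eq0 x : hnorm x = 0 -> x = 0.
Proof. by move=> h; apply/eqP; rewrite -normr_eq0 hnormE h. Qed.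

Lemma hnormN x : hnorm (- x) = hnorm x.
Proof. by rewrite /hnorm normrN. Qed.

Lemma hnormB x y : hnorm (x - y) = hnorm (y - x).
Proof. by rewrite -hnormN opprB. Qed.

Lemma hnormZ z x : hnorm (z *: x) = normc z * hnorm x.
Proof. by apply: complexI; rewrite -hnormE normrZ normCE hnormE rmorphM. Qed.

Lemma ler_hnormD x y : hnorm (x + y) <= hnorm x + hnorm y.
Proof. by rewrite -lecR rmorphD /= -!hnormE ler_normD. Qed.

Lemma ler_hnorm_dist x y z : hnorm (x - y) <= hnorm (x - z) + hnorm (z - y).
Proof. by rewrite -(subrK z x) -addrA addrK ler_hnormD. Qed.

Lemma ler_hnorm_sub x y : hnorm x <= hnorm y + hnorm (x - y).
Proof. by rewrite -{1}(subrK y x) addrC ler_hnormD. Qed.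

Lemma innerDl x y u : inner (x + y) u = inner x u + inner y u.
Proof. exact: linearDl. Qed.

Lemma innerDr x y u : inner u (x + y) = inner u x + inner u y.
Proof. exact: linearDr. Qed.

Lemma innerNl x u : inner (- x) u = - inner x u.
Proof. exact: linearNl. Qed.

Lemma innerNr x u : inner u (- x) = - inner u x.
Proof. exact: linearNr. Qed.

Lemma innerBl x y u : inner (x - y) u = inner x u - inner y u.
Proof. by rewrite innerDl innerNl. Qed.

Lemma innerBr x y u : inner u (x - y) = inner u x - inner u y.
Proof. by rewrite innerDr innerNr. Qed.

Lemma innerZl z x u : inner (z *: x) u = z * inner x u.
Proof. exact: linearZl_LR. Qed.

Lemma innerZr z x u : inner u (z *: x) = conjc z * inner u x.
Proof. exact: linearZr_LR. Qed.

Lemma inner0l u : inner (0 : H) u = 0.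
Proof. by rewrite -(scale0r (0 : H)) innerZl mul0r. Qed.

Lemma innerC x y : inner x y = conjc (inner y x).
Proof. by rewrite hermC /= expr0 mul1r. Qed.

Lemma inner_hnorm x : inner x x = (hnorm x ^+ 2)%:C.
Proof. by rewrite -normr_inner hnormE rmorphXn. Qed.

Lemma Re_innerC x y : complex.Re (inner x y) = complex.Re (inner y x).
Proof. by rewrite innerC ReJ. Qed.

Lemma hnormD_sqr x y :
  hnorm (x + y) ^+ 2 = hnorm x ^+ 2 + 2 * complex.Re (inner x y) + hnorm y ^+ 2.
Proof.
have e (z : H) : hnorm z ^+ 2 = complex.Re (inner z z) by rewrite inner_hnorm.
by rewrite !e innerDl !innerDr !ReD (Re_innerC y x); ring.
Qed.

Lemma inner_ext x y : (forall u, inner x u = inner y u) -> x = y.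
Proof.
move=> h; apply/eqP; rewrite -subr_eq0; apply/eqP/hnorm_eq0/eqP.
by rewrite -sqrf_eq0 -(inj_eq (@complexI R)) -inner_hnorm innerBl h subrr.
Qed.

Lemma Re_inner_le x y : complex.Re (inner x y) <= hnorm x * hnorm y.
Proof.
have [r0|] := leP (complex.Re (inner x y)) 0.
  by rewrite (le_trans r0) // mulr_ge0 ?hnorm_ge0.
move=> r0; rewrite -ler_sqr ?nnegrE ?mulr_ge0 ?hnorm_ge0 ?(ltW r0) // exprMn.
apply: le_sq_of_quadratic_ge0 => [|t]; first exact: sqr_ge0.
suff -> : hnorm x ^+ 2 + 2 * complex.Re (inner x y) * t + hnorm y ^+ 2 * t ^+ 2
  = hnorm (x + t%:C *: y) ^+ 2 by exact: sqr_ge0.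
rewrite hnormD_sqr innerZr conjc_real ReZ hnormZ normc_real exprMn.
by rewrite real_normK ?num_real //; ring.
Qed.

Lemma normc_inner_le x y : normc (inner x y) <= hnorm x * hnorm y.
Proof.
have [->|n0] := eqVneq (normc (inner x y)) 0.
  by rewrite mulr_ge0 ?hnorm_ge0.
have ngt0 : 0 < normc (inner x y) by rewrite lt_neqAle eq_sym n0 normc_ge0.
(* Multiplying [x] by the conjugate of [<x, y>] removes the phase: the inner product becomes the
   squared modulus, and one factor cancels. *)
have := Re_inner_le (conjc (inner x y) *: x) y.
rewrite innerZl mulrC -sqr_normcE /= hnormZ normc_conj expr2 -mulrA.
by rewrite ler_pM2l.
Qed.

Lemma Re_inner_ge x y : - (hnorm x * hnorm y) <= complex.Re (inner x y).
Proof. by rewrite lerNl -ReN -innerNl (le_trans (Re_inner_le _ _)) // hnormN. Qed.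

Definition hcvg (u : nat -> H) (l : H) := forall e : R, 0 < e ->
  exists N, forall n, (N <= n)%N -> hnorm (u n - l) <= e.

Lemma hcomplete (u : nat -> H) :
  (forall e : R, 0 < e ->
    exists N, forall m n, (N <= m)%N -> (N <= n)%N -> hnorm (u m - u n) <= e) ->
  exists l, hcvg u l.
Proof.
move=> cau; have /cauchy_cvg ucvg : cauchy (u @ \oo).
  apply/cauchy_exP => e e0.
  have e_re : e = (complex.Re e)%:C by rewrite RRe_real // gtr0_real.
  have er0 : 0 < complex.Re e / 2 by rewrite divr_gt0 // -ltcR -e_re.
  have [N hN] := cau _ er0; exists (u N); exists N => // n /= Nn.
  rewrite -ball_normE /ball_ /= hnormE e_re ltcR.
  apply: le_lt_trans (hN _ _ _ Nn) _ => //.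
  by rewrite gtr_pMr ?invf_lt1 ?ltr1n //; move: er0; rewrite pmulr_lgt0 ?invr_gt0.
exists (lim (u @ \oo)) => e e0.
have /cvgr_dist_le /(_ e%:C) : u @ \oo --> lim (u @ \oo) by [].
rewrite ltcR => /(_ e0) [N _ hN]; exists N => n Nn.
by have := hN n Nn; rewrite /= hnormE lecR hnormB.
Qed.

End HilbertSpace.

Section LinearMaps.
Context {R : realType} {H Y : hilbertType R}.

Lemma linear_mapD (B : H -> Y) : linear B -> {morph B : x y / x + y}.
Proof. by move=> l x y; have := l 1 x y; rewrite !scale1r. Qed.

Lemma linear_map0 (B : H -> Y) : linear B -> B 0 = 0.
Proof.
by move=> l; apply: (@addrI _ (B 0)); rewrite -(linear_mapD l) !addr0.
Qed.

Lemma linear_mapZ (B : H -> Y) : linear B -> forall z x, B (z *: x) = z *: B x.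
Proof. by move=> l z x; have := l z x 0; rewrite !addr0 (linear_map0 l) addr0. Qed.

Lemma linear_mapN (B : H -> Y) : linear B -> {morph B : x / - x}.
Proof. by move=> l x; rewrite -scaleN1r (linear_mapZ l) scaleN1r. Qed.

Lemma linear_mapB (B : H -> Y) : linear B -> {morph B : x y / x - y}.
Proof. by move=> l x y; rewrite (linear_mapD l) (linear_mapN l). Qed.

Lemma bounded_op_gt0 (B : H -> Y) : bounded_op B ->
  exists2 M : R, 0 < M & forall x, hnorm (B x) <= M * hnorm x.
Proof.
case=> _ [M hM]; exists (`|M| + 1); first by rewrite ltr_wpDl.
move=> x; apply: le_trans (hM x) _; rewrite ler_wpM2r ?hnorm_ge0 //.
by rewrite (le_trans (ler_norm M)) // lerDl.
Qed.

End LinearMaps.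

Section SelfAdjoint.
Context {R : realType} {H : hilbertType R}.

(** Polarisation over the complex numbers: reality of [<P z, z>] at [z = x + y] matches the
    imaginary parts of [<P x, y>] and [<x, P y>], and at [z = x + i y] the real parts. *)
Lemma positive_op_selfadjoint (P : H -> H) : linear P -> positive_op P ->
  is_adjoint P P.
Proof.
move=> l pos x y; have dC (z : H) : complex.Im (inner (P z) z) = 0.
  by apply: ger0_Im; exact: pos.
have := dC (x + y); have := dC (x + 'i%C *: y).
rewrite !(linear_mapD l) (linear_mapZ l) !innerDl !innerDr !innerZl !innerZr.
have := dC x; have := dC y; rewrite [inner x (P y)]innerC.
case: (inner (P x) x) => a b; case: (inner (P y) y) => c d.
case: (inner (P x) y) => e f; case: (inner (P y) x) => g h /= -> -> e1 e2.
by congr (_ +i* _); lra.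
Qed.

(** The form of [P] may be degenerate, but the discriminant argument only needs it to be
    nonnegative. It is applied with [y = P x], to make [P x] small when [<P x, x>] is small. *)
Lemma positive_op_CauchySchwarz (P : H -> H) x y : linear P -> positive_op P ->
  complex.Re (inner (P x) y) ^+ 2 <=
  complex.Re (inner (P x) x) * complex.Re (inner (P y) y).
Proof.
move=> l pos; have sa := positive_op_selfadjoint l pos.
have pos' (z : H) : 0 <= complex.Re (inner (P z) z).
  by have := pos z; rewrite lecE => /andP[].
apply: le_sq_of_quadratic_ge0 => // t.
suff -> : complex.Re (inner (P x) x) + 2 * complex.Re (inner (P x) y) * t +
    complex.Re (inner (P y) y) * t ^+ 2 =
  complex.Re (inner (P (x + t%:C *: y)) (x + t%:C *: y)) by [].
rewrite (linear_mapD l) (linear_mapZ l) !innerDl !innerDr !innerZl !innerZr.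
rewrite conjc_real !ReD !ReZ (sa y x) (Re_innerC y); ring.
Qed.

Lemma selfadjoint_inner_real (P : H -> H) x : is_adjoint P P ->
  inner (P x) x = (complex.Re (inner (P x) x))%:C.
Proof.
move=> sa; have : conjc (inner (P x) x) = inner (P x) x by rewrite -innerC sa.
by case: (inner (P x) x) => a b /= [h]; congr (_ +i* _); lra.
Qed.

End SelfAdjoint.

(** * Riesz representation and coercive operators *)

Lemma invn_le (R : realType) (e : R) : 0 < e ->
  exists N, forall n, (N <= n)%N -> n.+1%:R^-1 <= e.
Proof.
move=> e0; exists (Num.truncn e^-1) => n Nn.
rewrite -[leRHS]invrK lef_pV2 ?posrE ?invr_gt0 //.
have /andP[_ /ltW h] := truncn_itv (ltW (etrans (invr_gt0 e) e0)).
by rewrite (le_trans h) // ler_nat ltnS.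
Qed.

Section Riesz.
Context {R : realType} {H : hilbertType R}.

(* Minimise [x |-> <P x, x> - 2 Re (phi x)]. With [P] the identity this is the
   Riesz representation theorem; with [phi] represented it inverts [P]. *)
Lemma coercive_representation (P : H -> H) (c : R) (phi : H -> R[i]) (k : R) :
  bounded_op P -> is_adjoint P P -> 0 < c ->
  (forall x, c * hnorm x ^+ 2 <= complex.Re (inner (P x) x)) ->
  (forall x y, phi (x + y) = phi x + phi y) ->
  (forall z x, phi (z *: x) = z * phi x) ->
  (forall x, normc (phi x) <= k * hnorm x) ->
  exists u, forall x, phi x = inner x (P u).
Proof.
move=> Pb sa c0 coer phiD phiZ phik; have l := Pb.1.
have [M M0 PM] := bounded_op_gt0 Pb.
pose J x := complex.Re (inner (P x) x) - 2 * complex.Re (phi x).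
pose E : set R := range J.
have Elb : has_lbound E.
  (* The minimum of [c * s ^+ 2 - 2 * k * s] over real [s], found by completing the square. *)
  exists (- (k ^+ 2 / c)) => _ [x _ <-]; rewrite /J.
  have h1 := coer x; have h2 := le_trans (Re_le_normc (phi x)) (phik x).
  suff : 0 <= c * hnorm x ^+ 2 - 2 * (k * hnorm x) + k ^+ 2 / c by lra.
  have -> : c * hnorm x ^+ 2 - 2 * (k * hnorm x) + k ^+ 2 / c =
    c * (hnorm x - k / c) ^+ 2 by field; exact: lt0r_neq0.
  by rewrite mulr_ge0 ?sqr_ge0 ?ltW.
have Einf : has_inf E by split=> //; exists (J 0), 0.
have Jm x : inf E <= J x by apply: ge_inf => //; exists x.
have /choice[xs xsP] n : exists x, J x < inf E + n.+1%:R^-1.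
  have [|_ [x _ <-] hx] := @inf_adherent _ E n.+1%:R^-1 _ Einf; last by exists x.
  by rewrite invr_gt0 ltr0n.
(* Parallelogram law for the form of [P]; by coercivity it makes every minimising sequence
   Cauchy. *)
have par x y : J x + J y = 2 * J ((2^-1)%:C *: (x + y)) +
    2^-1 * complex.Re (inner (P (x - y)) (x - y)).
  rewrite /J (linear_mapZ l) (linear_mapD l) (linear_mapB l) phiZ phiD.
  rewrite !innerBl !innerBr !innerZl !innerZr !innerDl !innerDr conjc_real.
  by rewrite !(ReD, ReN, ReZ); field.
have Jdist x y : c * hnorm (x - y) ^+ 2 <= 2 * (J x + J y - 2 * inf E).
  have := coer (x - y); have := par x y; have := Jm ((2^-1)%:C *: (x + y)).
  by lra.
have [u hu] : exists u, hcvg xs u.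
  apply: hcomplete => e e0.
  have [|N hN] := @invn_le _ (c * e ^+ 2 / 4).
    by rewrite divr_gt0 // mulr_gt0 // exprn_gt0.
  exists N => m n Nm Nn; rewrite -ler_sqr ?nnegrE ?hnorm_ge0 ?(ltW e0) //.
  rewrite -(ler_pM2l c0) (le_trans (Jdist _ _)) //.
  have := hN _ Nm; have := hN _ Nn; have := xsP m; have := xsP n.
  by move: n.+1%:R^-1 m.+1%:R^-1 => a b; lra.
(* First variation at the minimiser. The increment of [J] along [v] is a quadratic in [t] without
   constant term that is never negative, so its linear coefficient vanishes. *)
have stat v : complex.Re (inner (P u) v) - complex.Re (phi v) = 0.
  apply/eqP; rewrite -sqrf_eq0 eq_le sqr_ge0 andbT.
  rewrite -[leRHS](mul0r (complex.Re (inner (P v) v))).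
  apply: le_sq_of_quadratic_ge0 => [|t].
    by apply: le_trans (coer v); rewrite mulr_ge0 ?sqr_ge0 // ltW.
  apply: (@ler_of_forall_mulr _ _ _ (2 * `|t| * (M * hnorm v) + 1)).
    by rewrite addr_ge0 // !mulr_ge0 ?hnorm_ge0 // ltW.
  move=> e e0; have [N1 hN1] := hu e e0; have [N2 hN2] := invn_le e0.
  set n := maxn N1 N2.
  have h1 := hN1 n (leq_maxl _ _); have h2 := hN2 n (leq_maxr _ _).
  have h3 := xsP n; have h4 := Jm (xs n + t%:C *: v).
  have e4 : J (xs n + t%:C *: v) = J (xs n) + 2 * t * complex.Re (inner (P (xs n)) v)
      + t ^+ 2 * complex.Re (inner (P v) v) - 2 * t * complex.Re (phi v).
    rewrite /J (linear_mapD l) (linear_mapZ l) phiD phiZ !innerDl !innerDr.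
    rewrite !innerZl !innerZr conjc_real !(ReD, ReN, ReZ) (sa v) (Re_innerC v).
    by ring.
  have h5 : t * complex.Re (inner (P (xs n)) v) <=
      t * complex.Re (inner (P u) v) + `|t| * (M * hnorm v) * e.
    rewrite -lerBlDl -mulrBr -ReN -ReD -innerBl -(linear_mapB l).
    rewrite (le_trans (ler_norm _)) // normrM -mulrA ler_wpM2l //.
    apply: (@le_trans _ _ (hnorm (P (xs n - u)) * hnorm v)).
      by rewrite ler_norml Re_inner_ge Re_inner_le.
    rewrite mulrAC ler_wpM2r ?hnorm_ge0 // (le_trans (PM _)) //.
    by rewrite ler_pM2l.
  rewrite e4 in h4; move: h2 h3 h4 h5; move: n.+1%:R^-1 => a; lra.
exists u => x; apply/eqP; rewrite -subr_eq0.
have lin : phi x - inner x (P u) = - (inner x (P u) - phi x) by rewrite opprB.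
have r1 : complex.Re (inner x (P u) - phi x) = 0.
  by rewrite ReD ReN -(stat x) (Re_innerC x).
(* The imaginary part is the real part at ['i * x], where stationarity applies as well. *)
have r2 : complex.Im (inner x (P u) - phi x) = 0.
  apply/eqP; rewrite -oppr_eq0 -ReiNIm mulrC mulrBr -innerZl -phiZ.
  by rewrite ReD ReN (Re_innerC (_ *: x)); apply/eqP; exact: stat.
by rewrite lin oppr_eq0 eq_complex r1 r2 !eqxx.
Qed.

(** [A - z] is normal, so a lower bound suffices for invertibility: the adjoint of [A - z] times
    [A - z] is coercive with constant [c ^+ 2], hence onto, and following its inverse by the adjoint
    of [A - z] gives a right inverse. Injectivity of [A - z] makes it a left inverse too. *)
Lemma notin_spectrum_of_bounded_below (A : H -> H) (z : R[i]) (c : R) :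
  bounded_op A -> is_adjoint A A -> 0 < c ->
  (forall x, c * hnorm x <= hnorm (A x - z *: x)) -> ~ spectrum A z.
Proof.
move=> Ab sa c0 below; have l := Ab.1; have [M M0 AM] := bounded_op_gt0 Ab.
pose Bz w x := A x - w *: x.
have BzD w x y : Bz w (x + y) = Bz w x + Bz w y.
  by rewrite /Bz (linear_mapD l) scalerDr opprD addrACA.
have BzZ w a x : Bz w (a *: x) = a *: Bz w x.
  by rewrite /Bz (linear_mapZ l) scalerBr !scalerA mulrC.
have BzN w x y : Bz w (x - y) = Bz w x - Bz w y.
  by rewrite BzD -scaleN1r BzZ scaleN1r.
have Bzadj w x y : inner (Bz w x) y = inner x (Bz (conjc w) y).
  by rewrite /Bz innerBl innerBr innerZl innerZr conjcK sa.
have Bzle w : exists2 K, 0 < K & forall x, hnorm (Bz w x) <= K * hnorm x.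
  exists (M + normc w); first by rewrite ltr_wpDr ?normc_ge0.
  move=> x; rewrite (le_trans (ler_hnormD _ _)) // hnormN hnormZ mulrDl.
  by rewrite lerD2r.
have Bzcomm w w' x : Bz w (Bz w' x) = Bz w' (Bz w x).
  rewrite /Bz !(linear_mapB l) !(linear_mapZ l) !scalerBr !scalerA (mulrC w).
  by rewrite [in LHS]opprD [LHS]addrACA -opprD.
have normal x : hnorm (Bz (conjc z) x) = hnorm (Bz z x).
  apply/eqP; rewrite -(eqrXn2 (n := 2)) ?hnorm_ge0 //.
  rewrite -(inj_eq (@complexI R)) -!inner_hnorm !Bzadj conjcK.
  by rewrite Bzcomm.
have inj x y : Bz z x = Bz z y -> x = y.
  move=> e; apply/eqP; rewrite -subr_eq0; apply/eqP/hnorm_eq0/eqP.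
  rewrite eq_le hnorm_ge0 andbT -(ler_pM2l c0) mulr0.
  by rewrite (le_trans (below _)) // -/(Bz z _) BzN e subrr hnorm0.
pose P x := Bz (conjc z) (Bz z x).
have [K1 K10 hK1] := Bzle z; have [K2 K20 hK2] := Bzle (conjc z).
have /choice[u hu] y : exists u, P u = y.
  have [|||||||u hu] := @coercive_representation P (c ^+ 2) (fun x => inner x y) (hnorm y).
  - split; first by move=> a x x'; rewrite /P (BzD z) (BzZ z) BzD BzZ.
    exists (K2 * K1) => x; rewrite (le_trans (hK2 _)) // -mulrA ler_pM2l //.
  - by move=> x x'; rewrite /P Bzadj conjcK Bzadj.
  - by rewrite exprn_gt0.
  - move=> x; rewrite /P Bzadj conjcK inner_hnorm /= -exprMn.
    by rewrite ler_sqr ?nnegrE ?mulr_ge0 ?hnorm_ge0 ?(ltW c0) // below.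
  - by move=> x x'; rewrite innerDl.
  - by move=> a x; rewrite innerZl.
  - by move=> x; rewrite mulrC normc_inner_le.
  exists u; apply: inner_ext => x.
  by rewrite [LHS]innerC [RHS]innerC -hu.
have BuE y : Bz z (Bz (conjc z) (u y)) = y by rewrite Bzcomm; exact: hu.
apply; exists (fun y => Bz (conjc z) (u y)); split.
(* The solution [u] comes from choice and carries no linearity; linearity of the inverse is
   recovered from injectivity of [A - z], and its bound [c^-1] from [below]. *)
- split; first by move=> a x y; apply: inj; rewrite BuE BzD BzZ !BuE.
  exists c^-1 => y; rewrite mulrC ler_pdivlMr // mulrC -[in leRHS](BuE y).
  exact: below.
- by move=> x; apply: inj; rewrite BuE.
- by move=> x; rewrite -[RHS]BuE.
Qed.

Lemma adjointP (Y : hilbertType R) (B : H -> Y) : bounded_op B ->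
  is_adjoint B (adjoint B).
Proof.
move=> Bb; have [M M0 BM] := bounded_op_gt0 Bb; have l := Bb.1.
suff /choice[D hD] y : exists u, forall x, inner (B x) y = inner x u.
  by apply: xgetPex; exists D => x y; exact: hD.
have [|||||u hu] := @coercive_representation idfun 1 (fun x => inner (B x) y)
  (M * hnorm y) _ (fun _ _ => erefl) ltr01.
- by split=> //; exists 1 => x; rewrite mul1r.
- by move=> x; rewrite mul1r inner_hnorm.
- by move=> x x'; rewrite (linear_mapD l) innerDl.
- by move=> a x; rewrite (linear_mapZ l) innerZl.
- by move=> x; rewrite (le_trans (normc_inner_le _ _)) // mulrAC ler_wpM2r ?hnorm_ge0.
by exists u.
Qed.

End Riesz.

(** * Polynomials of a positive operator and its spectrum *)

Section PolynomialCalculus.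
Context {R : realType} {H : hilbertType R}.
Implicit Types (A : H -> H) (p q : {poly R[i]}).

(** Operators are bare functions and not elements of a ring, so the value of [p] at [A] is written
    out on vectors. *)
Definition poly_op A p x : H := \sum_(i < size p) p`_i *: iter i A x.

Lemma poly_op_widen A p n x : (size p <= n)%N ->
  poly_op A p x = \sum_(i < n) p`_i *: iter i A x.
Proof.
move=> pn; rewrite /poly_op (big_ord_widen n (fun i => p`_i *: iter i A x)) //.
rewrite big_mkcond /=; apply: eq_bigr => i _; case: ltnP => // h.
by rewrite nth_default // scale0r.
Qed.

Lemma poly_opD A p q x : poly_op A (p + q) x = poly_op A p x + poly_op A q x.
Proof.
pose n := maxn (size (p + q)) (maxn (size p) (size q)).
rewrite !(@poly_op_widen _ _ n) /n ?leq_max ?leqnn ?orbT //.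
by rewrite -big_split; apply: eq_bigr => i _; rewrite coefD scalerDl.
Qed.

Lemma poly_opZ A (c : R[i]) p x : poly_op A (c *: p) x = c *: poly_op A p x.
Proof.
rewrite (@poly_op_widen _ _ (size p)) ?size_scale_leq // /poly_op scaler_sumr.
by apply: eq_bigr => i _; rewrite coefZ scalerA.
Qed.

Lemma poly_opN A p x : poly_op A (- p) x = - poly_op A p x.
Proof. by rewrite -scaleN1r poly_opZ scaleN1r. Qed.

Lemma poly_opB A p q x : poly_op A (p - q) x = poly_op A p x - poly_op A q x.
Proof. by rewrite poly_opD poly_opN. Qed.

Lemma poly_opC A (c : R[i]) x : poly_op A c%:P x = c *: x.
Proof.
by rewrite (@poly_op_widen _ _ 1) ?size_polyC_leq1 // big_ord1 coefC.
Qed.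

Lemma poly_opMX A p x : poly_op A (p * 'X) x = poly_op A p (A x).
Proof.
rewrite (@poly_op_widen _ _ (size p).+1); last first.
  by rewrite (leq_trans (size_polyMleq _ _)) // size_polyX addn2.
rewrite big_ord_recl coefMX /= scale0r add0r; apply: eq_bigr => i _.
by rewrite coefMX /= -iterSr.
Qed.

Lemma poly_opX A x : poly_op A 'X x = A x.
Proof. by rewrite -['X]mul1r poly_opMX poly_opC scale1r. Qed.

Lemma poly_op_linear A p : linear A -> linear (poly_op A p).
Proof.
move=> l; elim/poly_ind: p => [|p c IH] a x y.
  by rewrite /poly_op size_poly0 !big_ord0 scaler0 addr0.
rewrite !poly_opD !poly_opMX !poly_opC l IH scalerDr !scalerA (mulrC c).
by rewrite scalerDr scalerA addrACA.
Qed.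

Lemma poly_opXM A p x : linear A -> poly_op A ('X * p) x = A (poly_op A p x).
Proof.
move=> l; elim/poly_ind: p x => [|p c IH] x.
  by rewrite mulr0 /poly_op size_poly0 !big_ord0 (linear_map0 l).
rewrite mulrDr mulrA !poly_opD !poly_opMX IH (linear_mapD l).
by rewrite mulrC poly_opMX !poly_opC (linear_mapZ l).
Qed.

Lemma poly_opM A p q x : linear A ->
  poly_op A (p * q) x = poly_op A p (poly_op A q x).
Proof.
move=> l; elim/poly_ind: p q x => [|p c IH] q x.
  by rewrite mul0r /poly_op size_poly0 !big_ord0.
rewrite mulrDl -mulrA !poly_opD IH poly_opXM // poly_opMX poly_opC.
by rewrite mul_polyC poly_opZ.
Qed.

Lemma poly_op_bounded A p : bounded_op A -> bounded_op (poly_op A p).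
Proof.
move=> Ab; split; first exact: poly_op_linear Ab.1.
have [M M0 AM] := bounded_op_gt0 Ab; elim/poly_ind: p => [|p c [K IH]].
  by exists 0 => x; rewrite /poly_op size_poly0 big_ord0 hnorm0 mul0r.
exists (`|K| * M + normc c) => x.
rewrite poly_opD poly_opMX poly_opC (le_trans (ler_hnormD _ _)) // mulrDl.
rewrite hnormZ lerD2r (le_trans (IH _)) // -mulrA.
apply: (@le_trans _ _ (`|K| * hnorm (A x))).
  by rewrite ler_wpM2r ?hnorm_ge0 ?ler_norm.
by rewrite ler_wpM2l.
Qed.

(** Serves twice: [C = idfun] gives the adjoint of a polynomial in [A], the observation operator
    gives the symmetry of [<C x, C y>]. *)
Lemma poly_op_inner (Y : hilbertType R) (C : H -> Y) A p x y : linear A -> linear C ->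
  (forall u v, inner (C (A u)) (C v) = inner (C u) (C (A v))) ->
  inner (C (poly_op A p x)) (C y) = inner (C x) (C (poly_op A (map_poly conjc p) y)).
Proof.
move=> lA l sym; elim/poly_ind: p x y => [|p c IH] x y.
  rewrite rmorph0 /poly_op size_poly0 !big_ord0 !(linear_map0 l) inner0l.
  by rewrite innerC inner0l conjc0.
rewrite rmorphD rmorphM /= map_polyX map_polyC !poly_opD !poly_opMX !poly_opC.
rewrite !(linear_mapD l) !(linear_mapZ l) innerDl innerDr innerZl innerZr conjcK.
by rewrite IH sym -poly_opXM // mulrC poly_opMX.
Qed.

End PolynomialCalculus.

(** * Spectrum of a positive operator and positivity of polynomials in it *)

Section Spectrum.
Context {R : realType} {H : hilbertType R} (A : H -> H).
Context (Ab : bounded_op A) (Ap : positive_op A).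
Let l : linear A := Ab.1.
Let sa : is_adjoint A A := positive_op_selfadjoint l Ap.
Implicit Types (p q : {poly R[i]}).

Lemma positive_op_Re_ge0 x : 0 <= complex.Re (inner (A x) x).
Proof. by have := Ap x; rewrite lecE => /andP[]. Qed.

Lemma bounded_below_of_inner (z : R[i]) (c : R) :
  (forall x, c * hnorm x ^+ 2 <= normc (inner (A x - z *: x) x)) ->
  forall x, c * hnorm x <= hnorm (A x - z *: x).
Proof.
move=> h x; have := le_trans (h x) (normc_inner_le _ _).
have [->|n0] := eqVneq (hnorm x) 0; first by move=> _; rewrite mulr0 hnorm_ge0.
by rewrite expr2 mulrA ler_pM2r // lt_neqAle eq_sym n0 hnorm_ge0.
Qed.

(** A number off the half-line stays away from the numerical range of [A]: by [- Re z] if the real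
    part is negative, by [|Im z|] if it is not real. *)
Lemma spectrum_positive (z : R[i]) : spectrum A z -> 0 <= z.
Proof.
move=> sz; rewrite lecE /=; apply/andP; split; [apply: contraT => z0|]; last first.
  rewrite leNgt; apply/negP => z0; have c0 : 0 < - complex.Re z by rewrite oppr_gt0.
  apply: (notin_spectrum_of_bounded_below Ab sa c0 _ sz).
  apply: bounded_below_of_inner => x; apply: le_trans (Re_le_normc _).
  rewrite innerBl innerZl inner_hnorm ReD ReN ReZr -mulNr.
  by rewrite lerDr positive_op_Re_ge0.
exfalso; have c0 : 0 < `|complex.Im z| by rewrite normr_gt0.
apply: (notin_spectrum_of_bounded_below Ab sa c0 _ sz).
apply: bounded_below_of_inner => x.
rewrite innerBl innerZl inner_hnorm (selfadjoint_inner_real _ sa).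
apply: le_trans (_ : `|complex.Im z * hnorm x ^+ 2| <= _).
  by rewrite normrM (ger0_norm (sqr_ge0 _)).
rewrite -[leRHS](ger0_norm (normc_ge0 _)) -ler_sqr ?nnegrE // !real_normK ?num_real //.
rewrite normc_sqr; set r := complex.Re (inner _ _); set t := hnorm x ^+ 2.
have -> : complex.Im (r%:C - z * t%:C) = - (complex.Im z * t).
  by case: (z) => a b /=; ring.
by rewrite sqrrN lerDr sqr_ge0.
Qed.

Lemma spectrum_real (z : R[i]) : spectrum A z -> z = (complex.Re z)%:C.
Proof. by move=> /spectrum_positive z0; rewrite RRe_real // ger0_real. Qed.

Lemma spectrum_le (M : R) z : (forall x, hnorm (A x) <= M * hnorm x) ->
  spectrum A z -> complex.Re z <= M.
Proof.
move=> AM sz; rewrite leNgt; apply/negP => z0.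
have c0 : 0 < complex.Re z - M by rewrite subr_gt0.
apply: (notin_spectrum_of_bounded_below Ab sa c0 _ sz).
apply: bounded_below_of_inner => x; rewrite -normcN; apply: le_trans (Re_le_normc _).
rewrite innerBl innerZl inner_hnorm ReN ReD ReN ReZr opprB.
rewrite mulrBl lerD2l lerN2 (le_trans (Re_inner_le _ _)) //.
by rewrite expr2 mulrA ler_wpM2r ?hnorm_ge0.
Qed.

Lemma bounded_below_of_notin_spectrum z : ~ spectrum A z ->
  exists2 c : R, 0 < c & forall x, c * hnorm x <= hnorm (A x - z *: x).
Proof.
move=> /contrapT[B [Bb BA _]]; have [M M0 BM] := bounded_op_gt0 Bb.
exists M^-1; first by rewrite invr_gt0.
by move=> x; rewrite mulrC ler_pdivrMr // mulrC -{1}(BA x).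
Qed.

(** A lower bound [c] for [A - r] leaves [c / 2] after moving [r] by less than [c / 2], so the
    complement is open. *)
Lemma closed_real_spectrum : closed [set r : R | spectrum A r%:C].
Proof.
rewrite -openC openE => r /bounded_below_of_notin_spectrum[c c0 below].
have c20 : 0 < c / 2 by rewrite divr_gt0.
exists (c / 2) => //= r' rr' /=.
apply: (@notin_spectrum_of_bounded_below _ _ A _ (c / 2)) => // x.
have -> : A x - r'%:C *: x = (A x - r%:C *: x) - (r' - r)%:C *: x.
  by rewrite rmorphB /= scalerBl opprB addrA subrK.
have h1 := below x.
have h2 := ler_hnorm_sub (A x - r%:C *: x) ((A x - r%:C *: x) - (r' - r)%:C *: x).
rewrite subKr hnormZ normc_real distrC in h2.
have h3 : `|r - r'| * hnorm x <= c / 2 * hnorm x.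
  by rewrite ler_wpM2r ?hnorm_ge0 // ltW.
by lra.
Qed.

(** [m] is the infimum of [<B x, x>] over unit vectors, so [P = B - m] is positive and [<P x, x>]
    can be made small. Cauchy-Schwarz for the form of [P] then gives
    [|P x|^4 <= <P x, x> <P P x, P x>], which forces [P x] to be small. *)
Lemma not_bounded_below_bottom (B : H -> H) x0 : bounded_op B -> is_adjoint B B ->
  complex.Re (inner (B x0) x0) < 0 ->
  exists2 m : R, m < 0 & forall c : R, 0 < c ->
    exists x, hnorm (B x - m%:C *: x) < c * hnorm x.
Proof.
move=> Bb saB neg; have lB := Bb.1; have [M M0 BM] := bounded_op_gt0 Bb.
pose E := [set complex.Re (inner (B x) x) | x in [set x : H | hnorm x = 1]].
have unit x : x != 0 -> hnorm (((hnorm x)^-1)%:C *: x) = 1 /\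
    complex.Re (inner (B (((hnorm x)^-1)%:C *: x)) (((hnorm x)^-1)%:C *: x)) =
    complex.Re (inner (B x) x) / hnorm x ^+ 2.
  move=> x0'; have n0 : hnorm x != 0 by apply: contra x0' => /eqP/hnorm_eq0/eqP.
  rewrite hnormZ normc_real ger0_norm ?invr_ge0 ?hnorm_ge0 // mulVf //; split=> //.
  rewrite (linear_mapZ lB) innerZl innerZr conjc_real !ReZ expr2 invfM.
  by rewrite mulrA mulrC.
have x0n : x0 != 0.
  by apply: contraTneq neg => ->; rewrite (linear_map0 lB) inner0l ltxx.
have hx0 : 0 < hnorm x0.
  by rewrite lt_neqAle hnorm_ge0 andbT eq_sym; apply: contra x0n => /eqP/hnorm_eq0/eqP.
have [u1 u2] := unit _ x0n.
have Elb : has_lbound E.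
  exists (- M) => _ [x /= x1 <-]; rewrite (le_trans _ (Re_inner_ge _ _)) // lerN2.
  by rewrite x1 mulr1 (le_trans (BM _)) // x1 mulr1.
have Einf : has_inf E by split => //; eexists; exists (((hnorm x0)^-1)%:C *: x0); rewrite /= ?u1.
set m := inf E; have mE x : m * hnorm x ^+ 2 <= complex.Re (inner (B x) x).
  have [->|xn] := eqVneq x 0.
    by rewrite (linear_map0 lB) inner0l hnorm0 expr0n mulr0.
  have [v1 v2] := unit _ xn; have xp : 0 < hnorm x ^+ 2.
    rewrite exprn_gt0 // lt_neqAle hnorm_ge0 andbT eq_sym.
    by apply: contra xn => /eqP/hnorm_eq0/eqP.
  by rewrite -ler_pdivlMr // -v2; apply: ge_inf => //; eexists; last reflexivity.
have m0 : m < 0.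
  apply: (@le_lt_trans _ _ (complex.Re (inner (B x0) x0) / hnorm x0 ^+ 2)).
    by rewrite -u2; apply: ge_inf => //; eexists; last reflexivity.
  by rewrite pmulr_llt0 // invr_gt0 exprn_gt0.
exists m => // c c0; pose P x := B x - m%:C *: x.
have lP : linear P.
  by move=> a x y; rewrite /P lB scalerDr opprD addrACA scalerBr !scalerA mulrC.
have ReP x : complex.Re (inner (P x) x) = complex.Re (inner (B x) x) - m * hnorm x ^+ 2.
  by rewrite /P innerBl innerZl inner_hnorm ReD ReN ReZ.
have saP : is_adjoint P P.
  by move=> x y; rewrite /P innerBl innerBr innerZl innerZr conjc_real saB.
have pP : positive_op P.
  by move=> x; rewrite (selfadjoint_inner_real _ saP) ler0c ReP subr_ge0.
pose K := M - m; have K0 : 0 < K by rewrite subr_gt0 (lt_trans m0).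
(* [K] bounds the form of [P] from above, so [<P x, x> <= c ^+ 2 / (2 * K)] yields
   [|P x|^2 <= c ^+ 2 / 2], strictly below [c ^+ 2]. *)
have e0 : 0 < c ^+ 2 / (2 * K) by rewrite divr_gt0 ?exprn_gt0 ?mulr_gt0.
have [_ [x /= x1 <-] hx] := inf_adherent e0 Einf.
exists x; rewrite x1 mulr1.
have CS := positive_op_CauchySchwarz x (P x) lP pP.
rewrite -/(P x) -ltr_sqr ?nnegrE ?hnorm_ge0 ?(ltW c0) //.
rewrite inner_hnorm /= in CS.
have KP : complex.Re (inner (P (P x)) (P x)) <= K * hnorm (P x) ^+ 2.
  rewrite ReP mulrBl lerD2r (le_trans (Re_inner_le _ _)) // expr2 mulrA.
  by rewrite ler_wpM2r ?hnorm_ge0.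
have [->|Pn] := eqVneq (hnorm (P x)) 0; first by rewrite expr0n exprn_gt0.
have Px2 : 0 < hnorm (P x) ^+ 2 by rewrite exprn_gt0 // lt_neqAle eq_sym Pn hnorm_ge0.
have rx : complex.Re (inner (P x) x) <= c ^+ 2 / (2 * K).
  by rewrite ReP x1 expr1n mulr1 lerBlDl ltW.
have rx0 : 0 <= complex.Re (inner (P x) x) by rewrite ReP subr_ge0.
have : hnorm (P x) ^+ 2 * hnorm (P x) ^+ 2 <= c ^+ 2 / 2 * hnorm (P x) ^+ 2.
  rewrite -expr2 (le_trans CS) // (le_trans (ler_wpM2l rx0 KP)) //.
  rewrite mulrA ler_pM2r // -ler_pdivlMr // (le_trans rx) // invfM mulrA //.
rewrite ler_pM2r // => /le_lt_trans; apply.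
by rewrite gtr_pMr ?exprn_gt0 // invf_lt1 ?ltr1n.
Qed.

(** The nontrivial half of spectral mapping: [p] splits into linear factors, each root lies off the
    spectrum, and lower bounds multiply. *)
Lemma poly_op_bounded_below p : p != 0 -> (forall z, spectrum A z -> p.[z] != 0) ->
  exists2 c : R, 0 < c & forall x, c * hnorm x <= hnorm (poly_op A p x).
Proof.
move=> p0 noroot; have [r pE] := closed_field_poly_normal p.
have lc0 : lead_coef p != 0 by rewrite lead_coef_eq0.
have rs z : z \in r -> ~ spectrum A z.
  move=> zr /noroot/negP; apply; rewrite pE hornerZ mulf_eq0; apply/orP; right.
  by rewrite horner_prod prodf_seq_eq0; apply/hasP; exists z; rewrite //= hornerXsubC subrr.
have [c c0 hc] : exists2 c : R, 0 < c &
    forall x, c * hnorm x <= hnorm (poly_op A (\prod_(z <- r) ('X - z%:P)) x).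
  elim: r {pE} rs => [|z r IH] rs.
    by exists 1 => // x; rewrite big_nil poly_opC scale1r mul1r.
  have [|c c0 hc] := IH; first by move=> w wr; apply: rs; rewrite inE wr orbT.
  have [|d d0 hd] := @bounded_below_of_notin_spectrum z; first by apply: rs; rewrite mem_head.
  exists (d * c); first exact: mulr_gt0.
  move=> x; rewrite big_cons poly_opM // poly_opB poly_opX poly_opC.
  by rewrite (le_trans _ (hd _)) // -mulrA ler_pM2l.
exists (normc (lead_coef p) * c).
  rewrite mulr_gt0 // lt_neqAle normc_ge0 andbT eq_sym.
  by apply: contra lc0 => /eqP/eq0_normc ->.
by move=> x; rewrite {2}pE poly_opZ hnormZ -mulrA ler_wpM2l ?normc_ge0.
Qed.

(** If the form took a negative value, some [m < 0] would be an approximate eigenvalue of the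
    operator; but [q - m] has no zero on the spectrum, so it is bounded below. Constants are treated
    apart because [q - m] could be the zero polynomial. *)
Lemma poly_op_ge0 q : map_poly conjc q = q -> (forall z, spectrum A z -> 0 <= q.[z]) ->
  forall x, 0 <= complex.Re (inner (poly_op A q x) x).
Proof.
have nonconst p : (1 < size p)%N -> map_poly conjc p = p ->
    (forall z, spectrum A z -> 0 <= p.[z]) ->
    forall x, 0 <= complex.Re (inner (poly_op A p x) x).
  move=> sp pr p0 x; rewrite leNgt; apply/negP => neg.
  have pb := poly_op_bounded p Ab.
  have psa : is_adjoint (poly_op A p) (poly_op A p).
    move=> u v; have /= := @poly_op_inner _ _ H idfun A p u v l (fun _ _ _ => erefl) sa.
    by rewrite pr.
  have [m m0 hm] := not_bounded_below_bottom pb psa neg.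
  have szp : size (p - (m%:C)%:P) = size p.
    by rewrite size_polyDl // size_polyN (leq_ltn_trans (size_polyC_leq1 _)).
  have [||c c0 hc] := @poly_op_bounded_below (p - (m%:C)%:P).
  - by rewrite -size_poly_gt0 szp ltnW.
  - move=> z /p0 pz; rewrite hornerD hornerN hornerC subr_eq0.
    by apply: contraTneq pz => ->; rewrite ler0c -ltNge.
  have [y] := hm c c0; rewrite -(poly_opC A) -poly_opB => /lt_le_trans /(_ (hc y)).
  by rewrite ltxx.
move=> qr q0 x; have [sq|sq] := ltnP 1 (size q); first exact: nonconst.
have [[z sz]|nosp] := pselect (exists z, spectrum A z).
  have := q0 z sz; rewrite (size1_polyC sq) hornerC poly_opC innerZl inner_hnorm.
  by rewrite lecE ReZr => /andP[_ c0]; rewrite mulr_ge0 ?sqr_ge0.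
(* Over an empty spectrum every real polynomial qualifies. The choice [- ('X + 1)] gives
   [- <A x, x> - |x|^2 >= 0], hence [x = 0]. *)
have /(_ x) : forall x, 0 <= complex.Re (inner (poly_op A (- ('X + 1%:P)) x) x).
  apply: nonconst => [||z sz]; last by exfalso; apply: nosp; exists z.
    by rewrite size_polyN size_XaddC.
  by rewrite rmorphN rmorphD /= map_polyX map_polyC /=; congr (- (_ + _%:P)); exact: conjc1.
rewrite poly_opN poly_opD poly_opX poly_opC innerNl innerDl innerZl inner_hnorm.
rewrite mul1r ReN ReD /= => h; have h0 : hnorm x ^+ 2 = 0.
  by have := sqr_ge0 (hnorm x); have := positive_op_Re_ge0 x; lra.
have -> : x = 0 by apply: hnorm_eq0; apply/eqP; rewrite -sqrf_eq0 h0.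
by rewrite (linear_map0 (poly_op_linear _ l)) inner0l.
Qed.

(** Positivity applied to [s ^+ 2 - pc * p]. Since the spectrum is real, [pc * p] takes the value
    [|p|^2] there, and its form at [x] is the squared norm of [poly_op A p x]. *)
Lemma poly_op_norm_le p s : 0 <= s -> (forall z, spectrum A z -> normc p.[z] <= s) ->
  forall x, hnorm (poly_op A p x) <= s * hnorm x.
Proof.
move=> s0 ps x; pose pc := map_poly conjc p.
have pcc : map_poly conjc pc = p.
  by rewrite /pc -map_poly_comp map_poly_id // => z _ /=; rewrite conjcK.
have /(_ x) : forall x, 0 <= complex.Re (inner (poly_op A (((s ^+ 2)%:C)%:P - pc * p) x) x).
  apply: poly_op_ge0 => [|z sz].
    have cr (r : R) : map_poly conjc (r%:C)%:P = (r%:C)%:P.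
      by rewrite map_polyC; congr (_%:P); exact: conjc_real.
    move: (s ^+ 2) => r2; rewrite rmorphB rmorphM; congr (_ - _); first exact: cr.
    by rewrite /= -/pc pcc mulrC.
  have -> : pc = map_poly conjc p by [].
  rewrite hornerD hornerN hornerC hornerM (spectrum_real sz).
  rewrite -{1}[(complex.Re z)%:C]conjc_real horner_map -(spectrum_real sz) /=.
  rewrite mulrC -sqr_normcE -rmorphB ler0c subr_ge0.
  by rewrite ler_sqr ?nnegrE ?normc_ge0 ?ps.
rewrite poly_opB poly_opC poly_opM // innerBl innerZl inner_hnorm ReD ReN.
have := @poly_op_inner _ _ H idfun A pc (poly_op A p x) x l (fun _ _ _ => erefl) sa.
rewrite /= pcc inner_hnorm => -> /=; rewrite !mul0r subr0 subr_ge0 -exprMn.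
by rewrite ler_sqr ?nnegrE ?hnorm_ge0 ?mulr_ge0 ?hnorm_ge0.
Qed.

End Spectrum.

(** * Uniform approximation by polynomials on the spectrum *)

Section ContinuousOn.
Context {R : realType}.
Implicit Types (S : set R[i]) (f g : R[i] -> R[i]).

Lemma continuous_onP S f : continuous_on S f <->
  (forall z, S z -> forall e : R, 0 < e -> exists2 d : R, 0 < d &
    forall w, S w -> normc (z - w) < d -> normc (f z - f w) <= e).
Proof.
have Cpos (e : R[i]) : 0 < e -> exists2 r : R, 0 < r & e = r%:C.
  by move=> e0; exists (complex.Re e); rewrite -?ltcR RRe_real // gtr0_real.
split=> [/subspace_continuousP cf z Sz e e0|h].
  have /cvgrPdist_le/(_ e%:C) := cf z Sz.
  rewrite ltcR => /(_ e0) /nbhs_normP[d /= d0 hd].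
  have [r r0 dE] := Cpos _ d0; exists r => // w Sw zw.
  have := hd w; rewrite /ball_ /= dE normCE ltcR normCE lecR.
  exact.
apply/subspace_continuousP => z Sz; apply/cvgrPdist_le => e /Cpos[r r0 ->].
have [d d0 hd] := h z Sz r r0; apply/(@nbhs_normP _ R[i]^o z).
exists d%:C; first by rewrite /= ltcR.
by move=> w; rewrite /ball_ /= normCE ltcR normCE lecR => zw Sw; exact: hd.
Qed.

Lemma continuous_on_eq S f g : (forall z, S z -> f z = g z) ->
  continuous_on S f -> continuous_on S g.
Proof.
move=> fg /continuous_onP h; apply/continuous_onP => z Sz e e0.
have [d d0 hd] := h z Sz e e0; exists d => // w Sw zw.
by rewrite -!fg // hd.
Qed.

Lemma continuous_on_cst S (c : R[i]) : continuous_on S (fun=> c).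
Proof.
apply/continuous_onP => z Sz e e0; exists 1 => // w _ _.
by rewrite subrr normc0 ltW.
Qed.

Lemma continuous_on_id S : continuous_on S (fun z => z).
Proof. by apply/continuous_onP => z Sz e e0; exists e => // w _ /ltW. Qed.

Lemma continuous_onD S f g : continuous_on S f -> continuous_on S g ->
  continuous_on S (fun z => f z + g z).
Proof.
move=> /continuous_onP hf /continuous_onP hg; apply/continuous_onP => z Sz e e0.
have e20 : 0 < e / 2 by rewrite divr_gt0.
have [d d0 hd] := hf z Sz _ e20; have [d' d'0 hd'] := hg z Sz _ e20.
exists (Num.min d d'); first by rewrite lt_min d0.
move=> w Sw; rewrite lt_min => /andP[h1 h2].
rewrite opprD addrACA (le_trans (le_normcD _ _)) // [leRHS]splitr.
by rewrite lerD ?hd ?hd'.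
Qed.

Lemma continuous_onM S f g : continuous_on S f -> continuous_on S g ->
  continuous_on S (fun z => f z * g z).
Proof.
move=> /continuous_onP hf /continuous_onP hg; apply/continuous_onP => z Sz e e0.
(* [K] collects the coefficients of [e'] in the three-term expansion below; the product of the two
   differences costs only [e'] because [e' <= 1]. *)
pose K := normc (f z) + normc (g z) + 1.
have K0 : 0 < K by rewrite ltr_wpDl // addr_ge0 ?normc_ge0.
pose e' := Num.min 1 (e / K).
have e'0 : 0 < e' by rewrite lt_min ltr01 divr_gt0.
have [d d0 hd] := hf z Sz _ e'0; have [d' d'0 hd'] := hg z Sz _ e'0.
exists (Num.min d d'); first by rewrite lt_min d0.
move=> w Sw; rewrite lt_min => /andP[h1 h2].
have -> : f z * g z - f w * g w =
  (f z - f w) * g z + f z * (g z - g w) - (f z - f w) * (g z - g w) by ring.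
rewrite (le_trans (le_normcD _ _)) // normcN.
rewrite (le_trans (lerD (le_normcD _ _) (lexx _))) // !normcM.
have a1 := hd w Sw h1; have a2 := hd' w Sw h2.
have b1 : e' <= 1 by rewrite ge_min lexx.
have b2 : e' * K <= e by rewrite -ler_pdivlMr // ge_min lexx orbT.
apply: le_trans b2; rewrite /K !mulrDr mulr1.
have c1 : normc (f z - f w) * normc (g z) <= e' * normc (g z).
  by rewrite ler_wpM2r ?normc_ge0.
have c2 : normc (f z) * normc (g z - g w) <= e' * normc (f z).
  by rewrite mulrC ler_wpM2r ?normc_ge0.
have c3 : normc (f z - f w) * normc (g z - g w) <= e'.
  by rewrite -[leRHS]mulr1 ler_pM ?normc_ge0 // (le_trans a2).
by lra.
Qed.

Lemma continuous_on_conj S f : continuous_on S f ->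
  continuous_on S (fun z => Num.conj (f z)).
Proof.
move=> /continuous_onP h; apply/continuous_onP => z Sz e e0.
have [d d0 hd] := h z Sz e e0; exists d => // w Sw zw.
have -> : Num.conj (f z) - Num.conj (f w) = conjc (f z - f w) by rewrite rmorphB.
by rewrite normc_conj hd.
Qed.

Lemma continuous_on_real S f (phi : R -> R) : continuous_on S f ->
  (forall r, 0 <= r -> forall e, 0 < e -> exists2 d, 0 < d &
    forall s, 0 <= s -> `|r - s| < d -> `|phi r - phi s| <= e) ->
  (forall z, S z -> 0 <= complex.Re (f z)) ->
  continuous_on S (fun z => (phi (complex.Re (f z)))%:C).
Proof.
move=> /continuous_onP h hphi f0; apply/continuous_onP => z Sz e e0.
have [d d0 hd] := hphi _ (f0 _ Sz) e e0.
have d20 : 0 < d / 2 by rewrite divr_gt0.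
have [d' d'0 hd'] := h z Sz _ d20; exists d' => // w Sw zw.
rewrite -rmorphB normc_real hd ?f0 //.
apply: le_lt_trans (_ : d / 2 < d); last by rewrite gtr_pMr // invf_lt1 ?ltr1n.
apply: le_trans (hd' w Sw zw); rewrite -ReN -ReD.
rewrite -[leRHS]ger0_norm ?normc_ge0 // -ler_sqr ?nnegrE // !real_normK ?num_real //.
by rewrite normc_sqr lerDl sqr_ge0.
Qed.

End ContinuousOn.

Arguments continuous_on_cst {R} S c.
Arguments continuous_on_id {R} S.

Section PolynomialApproximation.
Context {R : realType}.

(** Near the diagonal continuity gives [e]; away from it [g] is bounded and [(r - s) ^+ 2] is
    bounded below. A quadratic error is what the Bernstein operator averages well, since it only
    involves a variance. *)
Lemma compact_quadratic_modulus (S : set R) (g : R -> R[i]) : compact S ->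
  (forall r, S r -> forall e : R, 0 < e -> exists2 d : R, 0 < d &
    forall s, S s -> `|r - s| < d -> normc (g r - g s) <= e) ->
  forall e, 0 < e -> exists2 K : R, 0 < K &
    forall r s, S r -> S s -> normc (g r - g s) <= e + K * (r - s) ^+ 2.
Proof.
move=> /compact_near_coveringP cS cg e e0.
have [N _ /(_ N (leqnn N)) gN] : \forall N \near \oo,
    S `<=` [set r | S r -> normc (g r) <= N%:R].
  apply: (cS nat \oo (fun N r => S r -> normc (g r) <= N%:R)) => r Sr.
  have [d d0 hd] := cg r Sr 1 ltr01.
  exists ([set s | `|r - s| < d], [set N | (Num.truncn (normc (g r) + 1)).+1 <= N]%N).
    split => /=; last by exists (Num.truncn (normc (g r) + 1)).+1.
    by apply/nbhs_normP; exists d.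
  move=> [s M] /= [rs NM] Ss; have := hd s Ss rs; rewrite normcB => h.
  have -> : g s = g r + (g s - g r) by rewrite addrC subrK.
  rewrite (le_trans (le_normcD _ _)) // (le_trans (lerD (lexx _) h)) //.
  rewrite ltW // (lt_le_trans (truncnS_gt _)) // ler_nat //.
have gB r : S r -> normc (g r) <= N%:R by move=> Sr; exact: gN.
have [K _ /(_ K (leqnn K)) gK] : \forall K \near \oo, S `<=` [set r | S r ->
    forall s, S s -> normc (g r - g s) <= e + K%:R * (r - s) ^+ 2].
  apply: (cS nat \oo (fun K r => S r -> forall s, S s ->
    normc (g r - g s) <= e + K%:R * (r - s) ^+ 2)) => r Sr.
  have e20 : 0 < e / 2 by rewrite divr_gt0.
  have [d d0 hd] := cg r Sr _ e20.
  have d20 : 0 < d / 2 by rewrite divr_gt0.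
  (* [2 N] bounds the difference of two values of [g], and [d / 2] is the least distance of the
     pairs not covered by continuity at [r]. *)
  pose K0 := N%:R * 2 / (d / 2) ^+ 2.
  exists ([set s | `|r - s| < d / 2], [set K | (Num.truncn K0).+1 <= K]%N).
    split => /=; last by exists (Num.truncn K0).+1.
    by apply/nbhs_normP; exists (d / 2).
  move=> [s K] /= [rs K0K] Ss t St.
  have KK0 : K0 <= K%:R.
    by rewrite ltW // (lt_le_trans (truncnS_gt _)) // ler_nat.
  have [rt|rt] := ltP `|r - t| d.
    apply: le_trans (_ : e <= _); last first.
      by rewrite lerDl mulr_ge0 ?sqr_ge0.
    have -> : g s - g t = (g s - g r) + (g r - g t) by rewrite addrA subrK.
    rewrite (le_trans (le_normcD _ _)) // [leRHS]splitr lerD ?hd //.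
    rewrite normcB hd // (lt_le_trans rs) // ler_pdivrMr // ler_pMr // ler1n //.
  have st : d / 2 <= `|s - t|.
    have : `|r - t| <= `|r - s| + `|s - t| by exact: ler_distD.
    by lra.
  apply: le_trans (_ : K0 * (s - t) ^+ 2 <= _); last first.
    by rewrite -[leLHS]add0r lerD ?(ltW e0) // ler_wpM2r ?sqr_ge0.
  apply: le_trans (_ : N%:R * 2 <= _).
    rewrite (le_trans (le_normcD _ _)) // normcN mulr_natr mulr2n lerD ?gB //.
  rewrite /K0 mulrAC ler_pdivlMr ?exprn_gt0 // ler_wpM2l ?mulr_ge0 //.
  rewrite -[leRHS]real_normK ?num_real // ler_sqr ?nnegrE //; exact: ltW.
exists K.+1%:R => // r s Sr Ss; apply: le_trans (gK r Sr Sr s Ss) _.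
by rewrite lerD2l ler_wpM2r ?sqr_ge0 // ler_nat.
Qed.

(* The Bernstein operator of degree [n] on [0, M] (with [v = 1 / M]), applied
   to a function with value [g k] at the node [k M / n]. *)
Fixpoint bernstein (v : R) (n : nat) (g : nat -> R[i]) : {poly R[i]} :=
  if n is n'.+1 then
    (1 - v%:C *: 'X) * bernstein v n' g +
    (v%:C *: 'X) * bernstein v n' (fun k => g k.+1)
  else (g 0%N)%:P.

(* The last factor is the second moment of the binomial law around [a]. *)
Lemma bernstein_dist v n g w (x a al be : R) : 0 <= v * x <= 1 ->
  (forall k, normc (g k - w) <= al + be * (k%:R - a) ^+ 2) ->
  normc ((bernstein v n g).[x%:C] - w) <=
    al + be * ((n%:R * (v * x) - a) ^+ 2 + n%:R * (v * x) * (1 - v * x)).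
Proof.
move=> /andP[y0 y1]; elim: n g a => [|n IH] g a h /=.
  by rewrite hornerC (le_trans (h 0%N)) // !mul0r addr0.
rewrite hornerD !hornerM hornerD hornerN !hornerZ hornerX hornerC -!rmorphM /=.
set P := (bernstein v n g).[_]; set Q := (bernstein v n _).[_].
have -> : (1 - (v * x)%:C) * P + (v * x)%:C * Q - w =
  (1 - v * x)%:C * (P - w) + (v * x)%:C * (Q - w).
  by rewrite rmorphB /=; ring.
rewrite (le_trans (le_normcD _ _)) // !normcM !normc_real.
rewrite !ger0_norm ?subr_ge0 //.
have h1 : normc (P - w) <= _ := IH g a h.
(* Conditioning on the first trial: a success shifts the index by one, so the centre [a] becomes
   [a - 1]. *)
have h2 : normc (Q - w) <=
    al + be * ((n%:R * (v * x) - (a - 1)) ^+ 2 + n%:R * (v * x) * (1 - v * x)).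
  apply: IH => k; rewrite (le_trans (h k.+1)) //.
  by have -> : k.+1%:R - a = k%:R - (a - 1) by rewrite -natr1; ring.
have y1' : 0 <= 1 - v * x by rewrite subr_ge0.
apply: le_trans (lerD (ler_wpM2l y1' h1) (ler_wpM2l y0 h2)) _.
by rewrite -natr1 le_eqVlt; apply/orP; left; apply/eqP; ring.
Qed.

(** The nodes [k M / n] need not lie in [S], so [g] is sampled at almost nearest points [z k] of
    [S]. Their distance to [x] is at most twice that of the node plus [de], so the error remains
    quadratic in the distance from [x] to the node. *)
Lemma compact_polynomial_approximation (S : set R) (M : R) (g : R -> R[i]) :
  compact S -> 0 < M -> S `<=` `[0, M] ->
  (forall r, S r -> forall e : R, 0 < e -> exists2 d : R, 0 < d &
    forall s, S s -> `|r - s| < d -> normc (g r - g s) <= e) ->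
  forall e, 0 < e -> exists p : {poly R[i]},
    forall r, S r -> normc (g r - p.[r%:C]) <= e.
Proof.
move=> cS M0 SM cg e e0.
have [[r0 Sr0]|nS] := pselect (exists r, S r); last first.
  by exists 0 => r Sr; exfalso; apply: nS; exists r.
have e20 : 0 < e / 2 by rewrite divr_gt0.
have [K K0 gK] := compact_quadratic_modulus cS cg e20.
(* Error budget: [e / 2] from the quadratic modulus, [e / 4] from the variance term [8 K M^2 / n],
   and [e / 4] from [2 K de^2], which uses [de ^+ 2 <= de]. *)
pose n := (Num.truncn (32 * K * M ^+ 2 / e)).+1.
have nK : 32 * K * M ^+ 2 / e <= n%:R by rewrite ltW // truncnS_gt.
pose de := Num.min 1 (e / (8 * K)).
have de0 : 0 < de by rewrite lt_min ltr01 divr_gt0 // mulr_gt0.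
have de1 : 2 * K * de ^+ 2 <= e / 4.
  have d1 : de <= 1 by rewrite ge_min lexx.
  have d2 : de * (8 * K) <= e by rewrite -ler_pdivlMr ?mulr_gt0 // ge_min lexx orbT.
  have : de ^+ 2 <= de by rewrite expr2 ger_pMr.
  by move=> h; have := ler_wpM2l (ltW K0) h; lra.
have /choice[z zP] k : exists s, S s /\ forall r, S r ->
    `|s - k%:R * M / n%:R| <= `|r - k%:R * M / n%:R| + de.
  set c := k%:R * M / n%:R.
  pose E := [set `|r - c| | r in S].
  have Elb : has_lbound E by exists 0 => _ [r _ <-].
  have Einf : has_inf E by split => //; exists `|r0 - c|, r0.
  have [_ [s Ss <-] hs] := inf_adherent de0 Einf.
  exists s; split=> // r Sr; rewrite (le_trans (ltW hs)) // lerD2r.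
  by apply: ge_inf => //; exists r.
exists (bernstein M^-1 n (g \o z)) => x Sx.
have n0 : 0 < n%:R :> R by rewrite ltr0n.
have /andP[x0 xM] : 0 <= x <= M by have := SM x Sx; rewrite /= in_itv.
have y01 : 0 <= M^-1 * x <= 1.
  by rewrite mulr_ge0 ?invr_ge0 ?(ltW M0) //= mulrC ler_pdivrMr ?mul1r.
(* Centring at [n x / M], the binomial mean, leaves only the variance. *)
rewrite normcB; apply: le_trans (@bernstein_dist _ n (g \o z) (g x) x (n%:R * (M^-1 * x))
    (e / 2 + 2 * K * de ^+ 2) (8 * K * (M / n%:R) ^+ 2) y01 _) _.
  move=> k /=; have [Sz hz] := zP k.
  apply: le_trans (gK _ _ Sz Sx) _; rewrite -addrA lerD2l.
  set c := k%:R * M / n%:R in hz; have hzx := hz x Sx.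
  have h1 : `|z k - x| <= 2 * `|x - c| + de.
    have := ler_distD c (z k) x; rewrite (distrC c x); lra.
  have h2 : (z k - x) ^+ 2 <= (2 * `|x - c| + de) ^+ 2.
    rewrite -[leLHS]real_normK ?num_real // ler_sqr ?nnegrE //.
    by rewrite addr_ge0 ?mulr_ge0 // ltW.
  have h3 : (2 * `|x - c| + de) ^+ 2 <= 2 * de ^+ 2 + 8 * (x - c) ^+ 2.
    rewrite -[(x - c) ^+ 2]real_normK ?num_real //.
    by have := sqr_ge0 (2 * `|x - c| - de); lra.
  have -> : 8 * K * (M / n%:R) ^+ 2 * (k%:R - n%:R * (M^-1 * x)) ^+ 2 =
      8 * K * (x - c) ^+ 2.
    by rewrite /c; field; rewrite !lt0r_neq0.
  have := ler_wpM2l (ltW K0) (le_trans h2 h3); lra.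
rewrite subrr expr0n add0r.
set y := M^-1 * x in y01 *.
have -> : 8 * K * (M / n%:R) ^+ 2 * (n%:R * y * (1 - y)) =
  8 * K * M ^+ 2 / n%:R * (y * (1 - y)) by field; exact: lt0r_neq0.
have h1 : 8 * K * M ^+ 2 / n%:R <= e / 4.
  by rewrite ler_pdivrMr //; move: nK; rewrite ler_pdivrMr //; lra.
have h0 : 0 <= 8 * K * M ^+ 2 / n%:R.
  by rewrite divr_ge0 ?ler0n // !mulr_ge0 ?sqr_ge0 // ltW.
have /andP[y0 y1] := y01.
have h2 : y * (1 - y) <= 1.
  by have := sqr_ge0 y; lra.
have := ler_wpM2l h0 h2; lra.
Qed.

Lemma spectrum_polynomial_approximation (H : hilbertType R) (A : H -> H)
    (f : R[i] -> R[i]) (e : R) : bounded_op A -> positive_op A ->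
  continuous_on (spectrum A) f -> 0 < e ->
  exists p : {poly R[i]}, forall z, spectrum A z -> normc (f z - p.[z]) <= e.
Proof.
move=> Ab Ap /continuous_onP cf e0; have [M M0 AM] := bounded_op_gt0 Ab.
pose S := [set r : R | spectrum A r%:C].
have SM : S `<=` `[0, M].
  move=> r Sr; rewrite /= in_itv /=; apply/andP; split.
    by rewrite -ler0c; exact: (spectrum_positive Ab Ap).
  exact: (spectrum_le Ab Ap AM Sr).
have cS : compact S.
  apply: (subclosed_compact _ (@segment_compact R 0 M) SM).
  exact: closed_real_spectrum.
have [|p hp] := @compact_polynomial_approximation S M (fun r => f r%:C) cS M0 SM _ e e0.
  move=> r Sr e' e'0; have [d d0 hd] := cf _ Sr e' e'0.
  by exists d => // s Ss rs; apply: hd => //; rewrite -rmorphB normc_real.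
exists p => z sz; have zE := spectrum_real Ab Ap sz.
by rewrite zE; apply: hp; rewrite /S /= -zE.
Qed.

End PolynomialApproximation.

(** * The continuous functional calculus *)

Lemma sqrt_modulus (R : realType) (r : R) : 0 <= r -> forall e, 0 < e ->
  exists2 d, 0 < d & forall s, 0 <= s -> `|r - s| < d ->
    `|Num.sqrt r - Num.sqrt s| <= e.
Proof.
move=> r0 e e0; exists (e ^+ 2); first by rewrite exprn_gt0.
move=> s s0 /ltW rs; rewrite -ler_sqr ?nnegrE ?(ltW e0) //.
apply: le_trans rs; rewrite -{2}(sqr_sqrtr r0) -{2}(sqr_sqrtr s0) subr_sqr.
rewrite expr2 normrM ler_wpM2l // [leRHS]ger0_norm ?addr_ge0 ?sqrtr_ge0 //.
by rewrite (le_trans (ler_normB _ _)) // !ger0_norm ?sqrtr_ge0.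
Qed.

Section ContinuousCalculus.
Context {R : realType} {H : hilbertType R} (A : H -> H).
Context (Ab : bounded_op A) (Ap : positive_op A).
Let l : linear A := Ab.1.
Let sa : is_adjoint A A := positive_op_selfadjoint l Ap.
Implicit Types (f g : R[i] -> R[i]) (p q : {poly R[i]}).

Definition approx f p (e : R) := forall z, spectrum A z -> normc (f z - p.[z]) <= e.

Lemma approx_conj f p e : approx f p e ->
  approx (fun z => Num.conj (f z)) (map_poly conjc p) e.
Proof.
move=> fp z sz; have zE := spectrum_real Ab Ap sz.
have -> : (map_poly conjc p).[z] = conjc p.[z].
  by rewrite zE -{1}[(complex.Re z)%:C]conjc_real horner_map.
have -> : Num.conj (f z) - conjc p.[z] = conjc (f z - p.[z]) by rewrite rmorphB.
by rewrite normc_conj fp.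
Qed.

Lemma poly_bounded_on_spectrum p :
  exists2 B : R, 0 <= B & forall z, spectrum A z -> normc p.[z] <= B.
Proof.
have [M M0 AM] := bounded_op_gt0 Ab.
elim/poly_ind: p => [|p c [B B0 IH]].
  by exists 0 => // z _; rewrite horner0 normc0.
exists (B * M + normc c) => [|z sz].
  by rewrite addr_ge0 ?normc_ge0 // mulr_ge0 // ltW.
rewrite hornerMXaddC (le_trans (le_normcD _ _)) // lerD2r normcM.
rewrite ler_pM ?normc_ge0 ?IH // (spectrum_real Ab Ap sz) normc_real.
rewrite ger0_norm ?(spectrum_le Ab Ap AM) //.
by have := spectrum_positive Ab Ap sz; rewrite lecE => /andP[].
Qed.

Lemma bounded_on_spectrum f : continuous_on (spectrum A) f ->
  exists2 B : R, 0 <= B & forall z, spectrum A z -> normc (f z) <= B.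
Proof.
move=> cf; have [p hp] := spectrum_polynomial_approximation Ab Ap cf ltr01.
have [B B0 hB] := poly_bounded_on_spectrum p.
exists (B + 1) => [|z sz]; first by rewrite addr_ge0.
rewrite -(subrK p.[z] (f z)) addrC (le_trans (le_normcD _ _)) //.
by rewrite lerD ?hB ?hp.
Qed.

Lemma approx_poly_op_dist f p q e d x : 0 <= e -> 0 <= d ->
  approx f p e -> approx f q d ->
  hnorm (poly_op A p x - poly_op A q x) <= (e + d) * hnorm x.
Proof.
move=> e0 d0 fp fq; rewrite -poly_opB; apply: poly_op_norm_le => //.
  by rewrite addr_ge0.
move=> z sz; have -> : (p - q).[z] = (p.[z] - f z) + (f z - q.[z]).
  by rewrite hornerD hornerN addrA subrK.
by rewrite (le_trans (le_normcD _ _)) // lerD ?fq // normcB fp.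
Qed.

(** The graph of [f(A)]: [v] is the value at [x] if polynomials uniformly close to [f] on the
    spectrum send [x] close to [v]. Each law of the calculus is then checked by exhibiting a
    polynomial. *)
Definition calculus_rel f x (v : H) := forall e : R, 0 < e ->
  exists2 p, approx f p e & hnorm (v - poly_op A p x) <= e.

(** Allows crude error constants, which may depend on [x], [v] and [f]. *)
Lemma calculus_rel_scale f x v (K : R) : 0 <= K ->
  (forall e, 0 < e -> exists2 p, approx f p (K * e) &
    hnorm (v - poly_op A p x) <= K * e) -> calculus_rel f x v.
Proof.
move=> K0 h e e0; have K1 : 0 < K + 1 by rewrite ltr_wpDl.
have [|p fp vp] := h (e / (K + 1)); first by rewrite divr_gt0.
have Ke : K * (e / (K + 1)) <= e.
  by rewrite mulrCA ger_pMr // ler_pdivrMr // mul1r lerDl.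
by exists p => [z sz|]; [apply: le_trans Ke; exact: fp | exact: le_trans Ke].
Qed.

Lemma calculus_rel_dist f x v p e : 0 <= e -> calculus_rel f x v -> approx f p e ->
  hnorm (v - poly_op A p x) <= e * hnorm x.
Proof.
move=> e0 fv fp; apply: (@ler_of_forall_mulr _ _ _ (1 + hnorm x)).
  by rewrite addr_ge0 ?hnorm_ge0.
move=> d d0; have [q fq vq] := fv d d0.
rewrite (le_trans (ler_hnorm_dist _ _ (poly_op A q x))) //.
have := approx_poly_op_dist x (ltW d0) e0 fq fp; lra.
Qed.

Lemma calculus_rel_unique f x v w :
  calculus_rel f x v -> calculus_rel f x w -> v = w.
Proof.
move=> fv fw; apply/eqP; rewrite -subr_eq0; apply/eqP/hnorm_eq0/le_anti.
rewrite hnorm_ge0 andbT; apply: (@ler_of_forall_mulr _ _ _ (1 + hnorm x)).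
  by rewrite addr_ge0 ?hnorm_ge0.
move=> e e0; have [p fp vp] := fv e e0; rewrite add0r.
rewrite (le_trans (ler_hnorm_dist _ _ (poly_op A p x))) // mulrDl mul1r lerD //.
by rewrite hnormB mulrC; exact: calculus_rel_dist (ltW e0) fw fp.
Qed.

Lemma calculus_rel_exists f x : continuous_on (spectrum A) f ->
  exists v, calculus_rel f x v.
Proof.
move=> cf; have /choice[p hp] n : exists p, approx f p n.+1%:R^-1.
  by apply: spectrum_polynomial_approximation => //; rewrite invr_gt0 ltr0n.
have invn0 n : 0 <= n.+1%:R^-1 :> R by rewrite invr_ge0.
have [v hv] : exists v, hcvg (fun n => poly_op A (p n) x) v.
  apply: hcomplete => e e0.
  have x1 : 0 < hnorm x + 1 by rewrite ltr_wpDl ?hnorm_ge0.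
  have [|N hN] := @invn_le _ (e / 2 / (hnorm x + 1)); first by rewrite !divr_gt0.
  exists N => m n Nm Nn.
  rewrite (le_trans (approx_poly_op_dist x (invn0 m) (invn0 n) (hp m) (hp n))) //.
  rewrite (le_trans (ler_wpM2r (hnorm_ge0 x) (lerD (hN _ Nm) (hN _ Nn)))) //.
  rewrite -mulrDl -splitr mulrAC ler_pdivrMr // ler_pM2l //.
  by rewrite lerDl.
exists v => e e0; have [N1 hN1] := hv e e0; have [N2 hN2] := invn_le e0.
exists (p (maxn N1 N2)) => [z sz|].
  by apply: le_trans (hN2 _ (leq_maxr N1 N2)); exact: hp.
by rewrite hnormB; apply: hN1; rewrite leq_maxl.
Qed.

Definition poly_calculus f x : H := xget 0 [set v | calculus_rel f x v].

Lemma poly_calculusP f x : continuous_on (spectrum A) f ->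
  calculus_rel f x (poly_calculus f x).
Proof. by move=> /(calculus_rel_exists x)[v hv]; exact: (xgetPex 0 (ex_intro _ v hv)). Qed.

Lemma poly_calculus_eq f x v : calculus_rel f x v -> poly_calculus f x = v.
Proof. by move=> fv; exact: calculus_rel_unique (xgetPex 0 (ex_intro _ v fv)) fv. Qed.

Lemma poly_calculus_dist f p e x : continuous_on (spectrum A) f -> 0 <= e ->
  approx f p e -> hnorm (poly_calculus f x - poly_op A p x) <= e * hnorm x.
Proof. by move=> cf e0; apply: calculus_rel_dist => //; exact: poly_calculusP. Qed.

(* Stated for any [Psi] close to the polynomial calculus so as to serve both for
   the construction and for an arbitrary calculus. *)
Lemma symmetric_of_dist (Y : hilbertType R) (C : H -> Y)
    (Psi : (R[i] -> R[i]) -> H -> H) f x y :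
  (forall f p e x, continuous_on (spectrum A) f -> 0 <= e -> approx f p e ->
    hnorm (Psi f x - poly_op A p x) <= e * hnorm x) ->
  bounded_op C -> (forall u v, inner (C (A u)) (C v) = inner (C u) (C (A v))) ->
  continuous_on (spectrum A) f ->
  inner (C (Psi f x)) (C y) = inner (C x) (C (Psi (fun z => Num.conj (f z)) y)).
Proof.
move=> Pd Cb sym cf; have cfc := continuous_on_conj cf.
have [M M0 CM] := bounded_op_gt0 Cb; have lC := Cb.1.
apply/eqP; rewrite -subr_eq0; apply/eqP/eq0_normc/le_anti.
rewrite normc_ge0 andbT.
apply: (@ler_of_forall_mulr _ _ _ (2 * M ^+ 2 * hnorm x * hnorm y)).
  by rewrite !mulr_ge0 ?hnorm_ge0 // ltW.
move=> e e0; rewrite add0r.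
have [p fp] := spectrum_polynomial_approximation Ab Ap cf e0.
have fpc := approx_conj fp.
set pc := map_poly conjc p in fpc; set fc := (fun z => _) in cfc fpc *.
have -> : inner (C (Psi f x)) (C y) - inner (C x) (C (Psi fc y)) =
  inner (C (Psi f x - poly_op A p x)) (C y) - inner (C x) (C (Psi fc y - poly_op A pc y)).
  rewrite !(linear_mapB lC) innerBl innerBr (poly_op_inner p x y l lC sym) -/pc.
  by ring.
rewrite (le_trans (le_normcD _ _)) // normcN.
have h1 : normc (inner (C (Psi f x - poly_op A p x)) (C y)) <=
    M * (e * hnorm x) * (M * hnorm y).
  rewrite (le_trans (normc_inner_le _ _)) // ler_pM ?hnorm_ge0 //.
  by rewrite (le_trans (CM _)) // ler_pM2l // Pd // ltW.
have h2 : normc (inner (C x) (C (Psi fc y - poly_op A pc y))) <=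
    M * hnorm x * (M * (e * hnorm y)).
  rewrite (le_trans (normc_inner_le _ _)) // ler_pM ?hnorm_ge0 //.
  by rewrite (le_trans (CM _)) // ler_pM2l // Pd // ltW.
by apply: le_trans (lerD h1 h2) _; rewrite le_eqVlt; apply/orP; left; apply/eqP; ring.
Qed.

Lemma bounded_op_id : bounded_op (@idfun H).
Proof. by split=> //; exists 1 => x; rewrite mul1r. Qed.

Lemma poly_calculus_bounded f : continuous_on (spectrum A) f ->
  bounded_op (poly_calculus f).
Proof.
move=> cf; split=> [a x y|].
  apply: poly_calculus_eq; apply: (@calculus_rel_scale _ _ _ (1 + normc a * hnorm x + hnorm y)).
    by rewrite !addr_ge0 ?mulr_ge0 ?normc_ge0 ?hnorm_ge0.
  move=> e e0; have [p fp] := spectrum_polynomial_approximation Ab Ap cf e0.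
  exists p => [z sz|].
    rewrite (le_trans (fp z sz)) // ler_peMl ?(ltW e0) // -addrA lerDl.
    by rewrite !addr_ge0 ?mulr_ge0 ?normc_ge0 ?hnorm_ge0.
  rewrite (poly_op_linear p l) opprD addrACA -scalerBr.
  rewrite (le_trans (ler_hnormD _ _)) // hnormZ.
  have h1 := ler_wpM2l (normc_ge0 a) (poly_calculus_dist x cf (ltW e0) fp).
  have h2 := poly_calculus_dist y cf (ltW e0) fp.
  by lra.
have [p fp] := spectrum_polynomial_approximation Ab Ap cf ltr01.
have [M M0 pM] := bounded_op_gt0 (poly_op_bounded p Ab).
exists (M + 1) => x; rewrite mulrDl.
rewrite (le_trans (ler_hnorm_sub _ (poly_op A p x))) // lerD //.
exact: poly_calculus_dist.
Qed.

Lemma poly_calculus_is_calculus : is_continuous_calculus A poly_calculus.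
Proof.
split.
- exact: poly_calculus_bounded.
- move=> f g cf cg fg; apply/funext => x; apply: poly_calculus_eq => e e0.
  have [p gp vp] := poly_calculusP x cg e0; exists p => // z sz.
  by rewrite fg // gp.
- move=> f g cf cg x; apply: poly_calculus_eq.
  apply: (@calculus_rel_scale _ _ _ (2 * (1 + hnorm x))).
    by rewrite mulr_ge0 // addr_ge0 ?hnorm_ge0.
  move=> e e0; have [p fp] := spectrum_polynomial_approximation Ab Ap cf e0.
  have [q gq] := spectrum_polynomial_approximation Ab Ap cg e0.
  have ex0 : 0 <= e * hnorm x by rewrite mulr_ge0 ?hnorm_ge0 // ltW.
  exists (p + q) => [z sz|].
    rewrite hornerD opprD addrACA (le_trans (le_normcD _ _)) //.
    by have := fp z sz; have := gq z sz; lra.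
  rewrite poly_opD opprD addrACA (le_trans (ler_hnormD _ _)) //.
  have := poly_calculus_dist x cf (ltW e0) fp.
  by have := poly_calculus_dist x cg (ltW e0) gq; lra.
- move=> c f cf x; apply: poly_calculus_eq.
  apply: (@calculus_rel_scale _ _ _ (normc c * (1 + hnorm x))).
    by rewrite mulr_ge0 ?normc_ge0 // addr_ge0 ?hnorm_ge0.
  move=> e e0; have [p fp] := spectrum_polynomial_approximation Ab Ap cf e0.
  exists (c *: p) => [z sz|].
    rewrite hornerZ -mulrBr normcM -mulrA ler_wpM2l ?normc_ge0 //.
    rewrite (le_trans (fp z sz)) // ler_peMl ?(ltW e0) // lerDl; exact: hnorm_ge0.
  rewrite poly_opZ -scalerBr hnormZ -mulrA ler_wpM2l ?normc_ge0 //.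
  have := poly_calculus_dist x cf (ltW e0) fp; lra.
- move=> f g cf cg x; set y := poly_calculus g x; apply: poly_calculus_eq.
  have [Bf Bf0 hBf] := bounded_on_spectrum cf.
  have [Bg Bg0 hBg] := bounded_on_spectrum cg.
  have [L L0 hL] := bounded_op_gt0 (poly_calculus_bounded cf).
  have lf := (poly_calculus_bounded cf).1.
  have x0 := hnorm_ge0 x; have y0 := hnorm_ge0 y.
  have Lx0 : 0 <= L * hnorm x by rewrite mulr_ge0 // ltW.
  apply: (@calculus_rel_scale _ _ _ (Bf + (Bg + 1) + L * hnorm x + (hnorm y + hnorm x))).
    by rewrite !addr_ge0.
  move=> e e0; have [p fp] := spectrum_polynomial_approximation Ab Ap cf e0.
  (* The bound [e' <= 1] keeps [q] below [Bg + 1] on the spectrum and the image of [x] under [q]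
     below [|y| + |x|], independently of [e]. *)
  pose e' := Num.min e 1; have e'0 : 0 < e' by rewrite lt_min e0 ltr01.
  have e'e : e' <= e by rewrite ge_min lexx.
  have e'1 : e' <= 1 by rewrite ge_min lexx orbT.
  have [q gq] := spectrum_polynomial_approximation Ab Ap cg e'0.
  exists (p * q) => [z sz|].
    have -> : f z * g z - (p * q).[z] = f z * (g z - q.[z]) + (f z - p.[z]) * q.[z].
      by rewrite hornerM; ring.
    rewrite (le_trans (le_normcD _ _)) // !normcM.
    have h1 : normc (f z) * normc (g z - q.[z]) <= Bf * e.
      by rewrite ler_pM ?normc_ge0 ?hBf // (le_trans (gq z sz)).
    have h2 : normc (f z - p.[z]) * normc q.[z] <= e * (Bg + 1).
      rewrite ler_pM ?normc_ge0 ?fp //.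
      have -> : q.[z] = g z + (q.[z] - g z) by rewrite addrC subrK.
      rewrite (le_trans (le_normcD _ _)) // lerD ?hBg // normcB.
      by rewrite (le_trans (gq z sz)).
    have := mulr_ge0 Lx0 (ltW e0).
    have := mulr_ge0 y0 (ltW e0); have := mulr_ge0 x0 (ltW e0); lra.
  rewrite poly_opM // (le_trans (ler_hnorm_dist _ _ (poly_calculus f (poly_op A q x)))) //.
  rewrite -(linear_mapB lf).
  have h1 : hnorm (y - poly_op A q x) <= e' * hnorm x.
    exact: poly_calculus_dist (ltW e'0) gq.
  have h2 : hnorm (poly_calculus f (y - poly_op A q x)) <= L * (e * hnorm x).
    rewrite (le_trans (hL _)) // ler_pM2l // (le_trans h1) //.
    by rewrite ler_wpM2r.
  have h3 := poly_calculus_dist (poly_op A q x) cf (ltW e0) fp.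
  have h4 : hnorm (poly_op A q x) <= hnorm y + hnorm x.
    rewrite (le_trans (ler_hnorm_sub _ y)) // lerD2l hnormB (le_trans h1) //.
    by rewrite ler_piMl.
  have := ler_wpM2l (ltW e0) h4.
  have := mulr_ge0 Bf0 (ltW e0).
  have := mulr_ge0 Bg0 (ltW e0); lra.
- move=> f cf x y; apply: (@symmetric_of_dist H idfun poly_calculus) => //.
    exact: poly_calculus_dist.
  exact: bounded_op_id.
- move=> x; apply: poly_calculus_eq => e e0; exists 1%:P => [z sz|].
    by rewrite hornerC subrr normc0 ltW.
  by rewrite poly_opC scale1r subrr hnorm0 ltW.
- move=> x; apply: poly_calculus_eq => e e0; exists 'X => [z sz|].
    by rewrite hornerX subrr normc0 ltW.
  by rewrite poly_opX subrr hnorm0 ltW.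
Qed.

(** [poly_calculus] is only a witness: the calculus returned by [xget] is known through its axioms
    alone. *)
Lemma continuous_calculusP : is_continuous_calculus A (continuous_calculus A).
Proof. exact: (xgetPex _ (ex_intro _ _ poly_calculus_is_calculus)). Qed.

(** * Consequences of the axioms for an arbitrary continuous calculus *)

Section AnyCalculus.
Context (Phi : (R[i] -> R[i]) -> H -> H) (PhiP : is_continuous_calculus A Phi).

Lemma continuous_on_poly p : continuous_on (spectrum A) (horner p).
Proof.
elim/poly_ind: p => [|p c IH].
  apply: (continuous_on_eq (f := fun=> 0)); last exact: continuous_on_cst.
  by move=> z _; rewrite horner0.
apply: (continuous_on_eq (f := fun z => p.[z] * z + c)).
  by move=> z _; rewrite hornerMXaddC.
exact: continuous_onD (continuous_onM IH (continuous_on_id _)) (continuous_on_cst _ c).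
Qed.

Lemma calculus_cst (c : R[i]) x : Phi (fun=> c) x = c *: x.
Proof.
have := calculusZ PhiP c (continuous_on_cst (spectrum A) 1) x.
rewrite (calculus1 PhiP) => <-; congr (Phi _ x).
by apply/funext => z; rewrite mulr1.
Qed.

Lemma calculus_poly p x : Phi (horner p) x = poly_op A p x.
Proof.
elim/poly_ind: p x => [|p c IH] x.
  rewrite -[0]/(0%:P) poly_opC -calculus_cst; congr (Phi _ x).
  by apply/funext => z; rewrite hornerC.
have -> : horner (p * 'X + c%:P) = (fun z => p.[z] * z + c).
  by apply/funext => z; rewrite hornerMXaddC.
have cp := @continuous_on_poly p; have ci := continuous_on_id (spectrum A).
rewrite (calculusD PhiP (continuous_onM cp ci) (continuous_on_cst _ c)).
by rewrite (calculusM PhiP cp ci) (calculus_id PhiP) IH calculus_cst poly_opD poly_opMX poly_opC.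
Qed.

(** [f] is the square of a real continuous [g], and moving one factor across gives [|C g(A) x|^2].
    Symmetry is a hypothesis to avoid a circle: the case [C = idfun], where it is an axiom, leads to
    [calculus_symmetric], which supplies it for general [C]. *)
Lemma calculus_nonneg (Y : hilbertType R) (C : H -> Y) f x :
  (forall g u v, continuous_on (spectrum A) g ->
    inner (C (Phi g u)) (C v) = inner (C u) (C (Phi (fun z => Num.conj (g z)) v))) ->
  continuous_on (spectrum A) f -> (forall z, spectrum A z -> 0 <= f z) ->
  0 <= complex.Re (inner (C (Phi f x)) (C x)).
Proof.
move=> sym cf f0.
have Ref0 z : spectrum A z -> 0 <= complex.Re (f z).
  by move=> /f0; rewrite lecE => /andP[].
pose g z := (Num.sqrt (complex.Re (f z)))%:C.
have cg : continuous_on (spectrum A) g.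
  by apply: continuous_on_real => //; exact: sqrt_modulus.
have fE z : spectrum A z -> f z = g z * g z.
  move=> sz; rewrite /g -rmorphM /= -expr2 sqr_sqrtr ?Ref0 //.
  by rewrite RRe_real // ger0_real // f0.
have cgg := continuous_onM cg cg.
rewrite (calculus_restrict PhiP cf cgg fE) (calculusM PhiP cg cg) (sym _ _ _ cg).
have -> : (fun z => Num.conj (g z)) = g by apply/funext => z; exact: conjc_real.
by rewrite inner_hnorm sqr_ge0.
Qed.

Lemma calculus_norm_le f s x : continuous_on (spectrum A) f -> 0 <= s ->
  (forall z, spectrum A z -> normc (f z) <= s) -> hnorm (Phi f x) <= s * hnorm x.
Proof.
move=> cf s0 fs; have cfc := continuous_on_conj cf.
have cff := continuous_onM cfc cf.
have cm := continuous_onM (continuous_on_cst (spectrum A) (-1)) cff.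
have cs := continuous_on_cst (spectrum A) ((s ^+ 2)%:C).
have := @calculus_nonneg H idfun _ x (fun g u v cg => calculus_adjoint PhiP cg u v)
  (continuous_onD cs cm).
have -> : Phi (fun z => (s ^+ 2)%:C + (-1) * (Num.conj (f z) * f z)) x =
    (s ^+ 2)%:C *: x - Phi (fun z => Num.conj (f z)) (Phi f x).
  rewrite (calculusD PhiP cs cm) calculus_cst (calculusZ PhiP _ cff) scaleN1r.
  by rewrite (calculusM PhiP cfc cf).
rewrite /= innerBl innerZl inner_hnorm ReD ReN ReZ /=.
have -> : inner (Phi (fun z => Num.conj (f z)) (Phi f x)) x = inner (Phi f x) (Phi f x).
  rewrite (calculus_adjoint PhiP cfc) ; congr (inner _ (Phi _ x)).
  by apply/funext => z; rewrite conjCK.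
rewrite inner_hnorm /= subr_ge0 -exprMn ler_sqr ?nnegrE ?mulr_ge0 ?hnorm_ge0 //.
apply=> z sz; rewrite mulN1r subr_ge0 mulrC -[Num.conj _]/(conjc _) -sqr_normcE.
by rewrite lecR ler_sqr ?nnegrE ?normc_ge0 // fs.
Qed.

(** Any calculus is as close to the polynomials in [A] as the constructed one, which is uniqueness
    in quantitative form. *)
Lemma calculus_dist f p e x : continuous_on (spectrum A) f -> 0 <= e ->
  approx f p e -> hnorm (Phi f x - poly_op A p x) <= e * hnorm x.
Proof.
move=> cf e0 fp; have cp := @continuous_on_poly (- p).
rewrite -poly_opN -calculus_poly -(calculusD PhiP cf cp).
apply: (calculus_norm_le x (continuous_onD cf cp) e0).
by move=> z sz; rewrite hornerN fp.
Qed.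

Lemma calculus_symmetric (Y : hilbertType R) (C : H -> Y) f x y : bounded_op C ->
  (forall u v, inner (C (A u)) (C v) = inner (C u) (C (A v))) ->
  continuous_on (spectrum A) f ->
  inner (C (Phi f x)) (C y) = inner (C x) (C (Phi (fun z => Num.conj (f z)) y)).
Proof. exact: (@symmetric_of_dist Y C Phi f x y (@calculus_dist)). Qed.

End AnyCalculus.

End ContinuousCalculus.

(** * Sums of powers over a set of linear growth *)

Section NonnegativeSums.
Context {R : realType} {I : choiceType}.
Implicit Types (D : set I) (f : I -> R).

Lemma sum_le_esum D f (s : seq I) : uniq s -> (forall i, i \in s -> D i) ->
  ((\sum_(i <- s) f i)%:E <= \esum_(i in D) (f i)%:E)%E.
Proof.
move=> us sD; apply: esum_ge; exists [set` s].
  by split; [exact: finite_seq|move=> i /= /sD].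
by rewrite -fsbig_seq // sumEFin.
Qed.

(** With [sum_le_esum] it reduces observability to finite sums over duplicate-free lists, so that
    only finitely many powers of [A] are compared at a time. *)
Lemma esum_le_of_sum_le D f (B : R) :
  (forall s : seq I, uniq s -> (forall i, i \in s -> D i) -> \sum_(i <- s) f i <= B) ->
  (\esum_(i in D) (f i)%:E <= B%:E)%E.
Proof.
move=> h; apply: ge_ereal_sup => _ [X [finX XD] <-].
rewrite fsbig_finite //= sumEFin lee_fin h // => i.
by rewrite in_fset_set // inE => /XD.
Qed.

End NonnegativeSums.

Lemma sum_seq_nat_le (R : realType) (f : nat -> R) (s : seq nat) (N : nat) :
  (forall n, 0 <= f n) -> uniq s -> (forall n, n \in s -> (n < N)%N) ->
  \sum_(n <- s) f n <= \sum_(0 <= n < N) f n.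
Proof.
move=> f0 us sN; rewrite [leRHS](bigID (mem s)) /= -[leLHS]addr0 lerD //; last first.
  by apply: sumr_ge0.
rewrite -[leRHS]big_filter le_eqVlt; apply/orP; left; apply/eqP/perm_big.
apply: uniq_perm => //; first by rewrite filter_uniq // iota_uniq.
move=> n; rewrite mem_filter mem_index_iota /=.
by case: (boolP (n \in s)) => // /sN ->.
Qed.

Lemma sum_nat_blocks (R : realType) (g : nat -> R) K n :
  \sum_(0 <= i < K * n) g i = \sum_(0 <= m < n) \sum_(0 <= j < K) g (K * m + j)%N.
Proof.
elim: n => [|n IH]; first by rewrite muln0 !big_geq.
rewrite big_nat_recr //= -IH mulnS (@big_cat_nat _ _ _ (K * n)) ?leq_addl //=.
congr (_ + _); rewrite -{1}[(K * n)%N]add0n big_addn addnK.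
by apply: eq_bigr => j _; rewrite addnC.
Qed.

Section CountingFunction.
Context {R : realType} (T : set R).
Context (T0 : T `<=` `[0, +oo[) (Tlf : locally_finite T).

Lemma size_le_counting (r : R) (s : seq R) : 0 < r -> uniq s ->
  (forall t, t \in s -> T t /\ t <= r) -> (size s <= counting_function T r)%N.
Proof.
move=> r0 us sT; rewrite /counting_function.
apply: uniq_leq_size => // t ts; have [Tt tr] := sT t ts.
rewrite in_fset_set ?inE /=; last exact: Tlf.
by split=> //; have := T0 Tt; rewrite /= !in_itv /= tr !andbT.
Qed.

Lemma exists_fresh_point (r : R) (s : seq R) : 0 < r ->
  (size s < counting_function T r)%N -> exists t, [/\ T t, t <= r & t \notin s].
Proof.
move=> r0 h; apply: contrapT => no.
suff : (counting_function T r <= size s)%N by rewrite leqNgt h.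
rewrite /counting_function; apply: uniq_leq_size; first exact: fset_uniq.
move=> t; rewrite in_fset_set ?inE /=; last exact: Tlf.
rewrite in_itv /= => -[Tt /andP[_ tr]]; apply: contrapT => /negP ts.
by apply: no; exists t.
Qed.

Lemma counting_le (r r' : R) : 0 < r -> r <= r' ->
  (counting_function T r <= counting_function T r')%N.
Proof.
move=> r0 rr; rewrite {1}/counting_function.
apply: size_le_counting; [exact: lt_le_trans rr|exact: fset_uniq|].
move=> t; rewrite in_fset_set ?inE /=; last exact: Tlf.
by rewrite in_itv /= => -[Tt /andP[_ /le_trans->]].
Qed.

(* Removing the largest point [t] of a finite part of [T] with [n + 1] points
   leaves [n < K * (floor t + 1)], whence [floor t >= n / K]. *)
Lemma powers_upper : linear_growth T -> exists2 K : nat, (0 < K)%N &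
  forall (s : seq R) (x : R), uniq s -> (forall t, t \in s -> T t) -> 0 <= x <= 1 ->
    \sum_(t <- s) (x `^ t) ^+ 2 <= K%:R * \sum_(0 <= n < size s) (x ^+ n) ^+ 2.
Proof.
case=> c [c' [r0 [c0 cc r00 gr]]].
have c'0 : 0 < c' by rewrite (lt_le_trans c0).
(* The growth bound holds only from [r0] on, so the count up to [t] is estimated by that up to
   [t + r0], and [t + r0 <= (1 + r0) * (floor t + 1)]. *)
pose K := (Num.truncn (c' * (1 + r0))).+1; exists K => // s x us sT /andP[x0 x1].
have sizeK s' t : uniq s' -> (forall u, u \in s' -> T u /\ u <= t) -> 0 <= t ->
    (size s' <= K * (Num.truncn t).+1)%N.
  move=> us' s't t0; rewrite -(ler_nat R) natrM.
  have tr0 : 0 < t + r0 by rewrite ltr_wpDl.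
  have h1 : (size s' <= counting_function T (t + r0))%N.
    apply: size_le_counting => // u /s't[Tu ut]; split=> //.
    by rewrite (le_trans ut) // lerDl ltW.
  have /andP[_ h2] := gr (t + r0) (ltac:(by rewrite lerDr)).
  rewrite -(ler_nat R) in h1; rewrite (le_trans h1) // (le_trans h2) //.
  have h3 : t <= (Num.truncn t).+1%:R by rewrite ltW // truncnS_gt.
  have h4 : c' * (1 + r0) <= K%:R by rewrite ltW // truncnS_gt.
  have h5 : 1 <= (Num.truncn t).+1%:R :> R by rewrite ler1n.
  apply: le_trans (ler_wpM2r (ler0n _ _) h4).
  rewrite -mulrA ler_pM2l // mulrDl mul1r lerD // ler_peMr //; exact: ltW.
apply: (@le_trans _ _ (\sum_(0 <= i < size s) (x ^+ (i %/ K)) ^+ 2)).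
  have [n sn] : exists n, size s = n by exists (size s).
  rewrite sn; elim: n s us sT sn => [|n IH] s us sT sn.
    by rewrite (size0nil sn) big_nil big_geq.
  have [t ts tmax] : exists2 t, t \in s & forall u, u \in s -> u <= t.
    case: s sn {us sT} => // a s _; elim: s a => [|b s IHs] a.
      by exists a; rewrite ?mem_head // => u; rewrite inE => /eqP ->.
    have [t ts tm] := IHs b; have [at_|ta] := leP a t.
      exists t; first by rewrite (in_cons a) ts orbT.
      by move=> u; rewrite (in_cons a) => /predU1P[->//|]; exact: tm.
    exists a; rewrite ?mem_head // => u; rewrite (in_cons a) => /predU1P[->//|/tm ut].
    by rewrite (le_trans ut) // ltW.
  have t0 : 0 <= t by have := T0 (sT t ts); rewrite /= in_itv /= andbT.
  rewrite (perm_big _ (perm_to_rem ts)) /= big_cons big_nat_recr //= addrC lerD //.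
    apply: IH; first exact: rem_uniq.
      by move=> u /mem_rem; exact: sT.
    by rewrite size_rem // sn.
  have nK : (n %/ K <= Num.truncn t)%N.
    rewrite -ltnS ltn_divLR // mulnC -sn; apply: sizeK => // u us'.
    by split; [exact: sT|exact: tmax].
  have nt : (n %/ K)%:R <= t.
    by have /andP[h _] := truncn_itv t0; rewrite (le_trans _ h) // ler_nat.
  rewrite ler_sqr ?nnegrE ?powR_ge0 ?exprn_ge0 // -powR_mulrn //.
  (* Antitonicity in the exponent needs a positive base. At [x = 0] the left side is nonzero only
     for [t = 0], and then [n %/ K <= t] makes the other exponent [0] as well. *)
  have [x_eq0|xn0] := eqVneq x 0; last first.
    by apply: ger_powR => //; rewrite lt_neqAle eq_sym xn0 x0.
  have [t_eq0|tn0] := eqVneq t 0; last by rewrite x_eq0 powR0 // powR_ge0.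
  by rewrite t_eq0 in nt *; have := le_anti (introT andP (conj nt (ler0n _ _))) => ->.
have [->|sn] := eqVneq (size s) 0%N; first by rewrite !big_geq // mulr0.
(* Enlarging the range completes the blocks, in which each exponent occurs exactly [K] times. *)
apply: (@le_trans _ _ (\sum_(0 <= i < K * size s) (x ^+ (i %/ K)) ^+ 2)).
  rewrite [leRHS](@big_cat_nat _ _ _ (size s)) ?leq_pmull //= lerDl.
  by apply: sumr_ge0 => i _; rewrite sqr_ge0.
rewrite sum_nat_blocks mulr_sumr; apply: ler_sum => m _.
rewrite big_nat (eq_bigr (fun=> (x ^+ m) ^+ 2)); last first.
  by move=> j /andP[_ jK]; rewrite mulnC divnMDl // divn_small // addn0.
by rewrite -big_nat sumr_const_nat subn0 mulr_natl.
Qed.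

(** Distinct points of [T] are picked greedily, the [j]-th one at most [D * j], counting from
    [j = 0]. The power of [x] at that point then dominates [x ^+ (D * j)], hence each exponent in
    the block of length [D] starting there. *)
Lemma powers_lower : T 0 -> linear_growth T -> exists2 D : nat, (0 < D)%N &
  forall J : nat, exists s : seq R, [/\ uniq s, (forall t, t \in s -> T t) &
    forall x : R, 0 <= x <= 1 ->
    \sum_(0 <= n < D * J) (x ^+ n) ^+ 2 <= D%:R * \sum_(t <- s) (x `^ t) ^+ 2].
Proof.
move=> T00 [c [c' [r0 [c0 cc r00 gr]]]].
(* For [j >= 1] this puts [D * j] beyond [r0], and [c * D * j >= 2 * j > j] leaves a point not yet
   chosen. *)
pose D := (Num.truncn (r0 + 2 / c)).+1; exists D => // J.
have hD : r0 + 2 / c <= D%:R by rewrite ltW // truncnS_gt.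
have c20 : 0 < 2 / c by rewrite divr_gt0.
have [s [us ss sT hs]] : exists s : seq R, [/\ uniq s, size s = J,
    (forall t, t \in s -> T t) & forall x : R, 0 <= x <= 1 ->
    \sum_(0 <= m < J) (x ^+ (D * m)) ^+ 2 <= \sum_(t <- s) (x `^ t) ^+ 2].
  elim: J => [|J [s [us ss sT hs]]].
    by exists [::]; split=> // x _; rewrite big_geq // big_nil.
  have [t [Tt tD ts]] : exists t, [/\ T t, t <= (D * J)%:R & t \notin s].
    case: J ss {hs} => [|J] ss.
      (* The first point must be at most [0]: this is where [0 \in T] is used. *)
      by exists 0; rewrite (size0nil ss); split.
    have r0D : r0 <= (D * J.+1)%:R.
      rewrite natrM; apply: (@le_trans _ _ (D%:R * 1)); first by lra.
      by rewrite ler_wpM2l // ler1n.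
    apply: exists_fresh_point; first by rewrite ltr0n muln_gt0.
    rewrite ss -(ltr_nat R); have /andP[+ _] := gr _ r0D; apply: lt_le_trans.
    rewrite natrM mulrA; apply: (@lt_le_trans _ _ (2 * J.+1%:R)).
      by rewrite -natrM ltr_nat mul2n -addnn -addn1 leq_add2l.
    rewrite ler_wpM2r // -ler_pdivrMl // mulrC; lra.
  exists (t :: s); split => /=; [by rewrite ts|by rewrite ss|..].
    by move=> u; rewrite inE => /predU1P[->//|]; exact: sT.
  move=> x /[dup] x01 /andP[x0 x1]; rewrite big_cons big_nat_recr //= addrC lerD //; last exact: hs.
  rewrite ler_sqr ?nnegrE ?powR_ge0 ?exprn_ge0 // -powR_mulrn //.
  have [x_eq0|xn0] := eqVneq x 0; last first.
    by apply: ger_powR => //; rewrite lt_neqAle eq_sym xn0 x0.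
  have [dz|dn0] := eqVneq (D * J)%:R (0 : R); last by rewrite x_eq0 powR0 // powR_ge0.
  have t0 : 0 <= t by have := T0 Tt; rewrite /= in_itv /= andbT.
  rewrite dz in tD *; suff -> : t = 0 by [].
  by apply/le_anti/andP.
exists s; split=> // x /[dup] x01 /andP[x0 x1].
rewrite sum_nat_blocks; apply: le_trans (ler_wpM2l (ler0n _ _) (hs x x01)).
rewrite mulr_sumr; apply: ler_sum => m _.
apply: (@le_trans _ _ (\sum_(0 <= j < D) (x ^+ (D * m)) ^+ 2)).
  apply: ler_sum => j _; rewrite ler_sqr ?nnegrE ?exprn_ge0 //.
  by rewrite ler_wiXn2l // leq_addr.
by rewrite sumr_const_nat subn0 mulr_natl.
Qed.

End CountingFunction.

(** The power [t^-1] is an increasing inverse on the half-line, so the preimages [lo] and [hi] of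
    the target interval bound the admissible [s], also at [r = 0]. *)
Lemma powR_modulus (R : realType) (t : R) : 0 < t -> forall r : R, 0 <= r ->
  forall e, 0 < e -> exists2 d, 0 < d & forall s, 0 <= s -> `|r - s| < d ->
    `|r `^ t - s `^ t| <= e.
Proof.
move=> t0 r r0 e e0; have tV (x : R) : 0 <= x -> (x `^ t^-1) `^ t = x.
  by move=> x0; rewrite -powRrM mulVf ?powRr1 // lt0r_neq0.
have Vt (x : R) : 0 <= x -> (x `^ t) `^ t^-1 = x.
  by move=> x0; rewrite -powRrM mulfV ?powRr1 // lt0r_neq0.
have tV0 : 0 < t^-1 by rewrite invr_gt0.
have rt0 := powR_ge0 r t.
pose hi := (r `^ t + e) `^ t^-1; pose lo := (r `^ t - e) `^ t^-1.
have rhi : r < hi.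
  by rewrite -{1}(Vt r r0) gt0_ltr_powR ?nnegrE ?addr_ge0 ?ltrDl // ltW.
have up s : 0 <= s -> s <= hi -> s `^ t <= r `^ t + e.
  move=> s0 sh; rewrite -(tV (r `^ t + e)) ?addr_ge0 ?(ltW e0) //.
  by rewrite ge0_ler_powR ?nnegrE ?powR_ge0 ?(ltW t0).
(* Here the lower bound is automatic, and [lo] would be a power of a nonpositive number. *)
have [re|re] := leP (r `^ t) e.
  exists (hi - r); first by rewrite subr_gt0.
  move=> s s0; rewrite ltr_norml => /andP[h1 h2].
  have := up s s0 (ltac:(lra)); have := powR_ge0 s t.
  by rewrite ler_norml => h3 h4; apply/andP; split; lra.
have lor : lo < r.
  by rewrite /lo -[ltRHS](Vt r r0) gt0_ltr_powR ?nnegrE ?subr_ge0 ?(ltW re) // gtrDl oppr_lt0.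
exists (Num.min (hi - r) (r - lo)); first by rewrite lt_min !subr_gt0 rhi.
move=> s s0; rewrite lt_min !ltr_norml => /andP[/andP[h1 h2] /andP[h3 h4]].
have := up s s0 (ltac:(lra)).
have : r `^ t - e <= s `^ t.
  rewrite -(tV (r `^ t - e)) ?subr_ge0 ?(ltW re) //.
  by rewrite ge0_ler_powR ?nnegrE ?powR_ge0 ?(ltW t0) //; rewrite -/lo; lra.
by rewrite ler_norml => h5 h6; apply/andP; split; lra.
Qed.

(** * Linear growth is sufficient *)

Section Powers.
Context {R : realType} {H : hilbertType R} (A : H -> H).
Context (Ab : bounded_op A) (Ap : positive_op A).
Local Notation Phi := (continuous_calculus A).
Let PhiP : is_continuous_calculus A Phi := continuous_calculusP Ab Ap.

Definition power_fun (t : R) (z : R[i]) : R[i] := (complex.Re z `^ t)%:C.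

Lemma spectrum_Re_ge0 z : spectrum A z -> 0 <= complex.Re z.
Proof. by move=> /(spectrum_positive Ab Ap); rewrite lecE => /andP[]. Qed.

Lemma continuous_on_power (t : R) : 0 <= t ->
  continuous_on (spectrum A) (power_fun t).
Proof.
move=> t0; have [->|tn0] := eqVneq t 0.
  apply: (continuous_on_eq (f := fun=> 1)); last exact: (continuous_on_cst _ 1).
  by move=> z _; rewrite /power_fun powRr0.
have tgt0 : 0 < t by rewrite lt_neqAle eq_sym tn0.
exact: (continuous_on_real (continuous_on_id _) (powR_modulus tgt0) spectrum_Re_ge0).
Qed.

(** The separate clause for [t = 0] agrees with the calculus because the power with exponent [0] is
    [1] even at [0]. *)
Lemma op_power_calculus (t : R) x : op_power A t x = Phi (power_fun t) x.
Proof.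
rewrite /op_power; have [->|//] := eqVneq t 0.
rewrite -[LHS](calculus1 PhiP); congr (Phi _ x).
by apply/funext => z; rewrite /power_fun powRr0.
Qed.

Lemma op_power_nat (n : nat) x : op_power A n%:R x = iter n A x.
Proof.
rewrite op_power_calculus; transitivity (Phi (horner 'X^n) x).
  congr (_ x); apply: (calculus_restrict PhiP).
  - exact: continuous_on_power.
  - exact: (@continuous_on_poly _ _ A 'X^n).
  - move=> z sz; rewrite hornerXn {2}(spectrum_real Ab Ap sz) -rmorphXn /=.
    by rewrite /power_fun powR_mulrn // spectrum_Re_ge0.
rewrite (calculus_poly PhiP); elim: n => [|n IH]; first by rewrite poly_opC scale1r.
by rewrite exprS (poly_opXM _ _ Ab.1) IH.
Qed.

Context {Y : hilbertType R} (C : H -> Y) (Cb : bounded_op C).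
Context (CA : forall u v, inner (C (A u)) (C v) = inner (C u) (C (A v))).

Let quad f x : R := complex.Re (inner (C (Phi f x)) (C x)).

Lemma calculus_quad_le f g x :
  continuous_on (spectrum A) f -> continuous_on (spectrum A) g ->
  (forall z, spectrum A z -> f z <= g z) -> quad f x <= quad g x.
Proof.
move=> cf cg fg; have cm := continuous_onM (continuous_on_cst (spectrum A) (-1)) cf.
rewrite -subr_ge0.
have -> : quad g x - quad f x = quad (fun z => g z + (-1) * f z) x.
  rewrite /quad (calculusD PhiP cg cm) (calculusZ PhiP _ cf) scaleN1r.
  by rewrite (linear_mapB Cb.1) innerBl ReD ReN.
rewrite /quad; apply: (calculus_nonneg PhiP (C := C)) => [h u v ch||z /fg].
- exact: (calculus_symmetric Ab Ap PhiP u v Cb CA ch).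
- exact: continuous_onD cg cm.
- by rewrite mulN1r subr_ge0.
Qed.

Let square_sum (s : seq R) (z : R[i]) : R[i] :=
  (\sum_(t <- s) (complex.Re z `^ t) ^+ 2)%:C.

Lemma continuous_on_square_sum (s : seq R) : (forall t, t \in s -> 0 <= t) ->
  continuous_on (spectrum A) (square_sum s).
Proof.
elim: s => [|t s IH] s0.
  apply: (continuous_on_eq (f := fun=> 0)); last exact: (continuous_on_cst _ 0).
  by move=> z _; rewrite /square_sum big_nil.
have ct := continuous_on_power (s0 t (mem_head _ _)).
have cs := IH (fun u us => s0 u (mem_behead (s := t :: s) us)).
apply: (continuous_on_eq _ (continuous_onD (continuous_onM ct ct) cs)) => z _.
by rewrite /square_sum big_cons rmorphD /= -rmorphM.
Qed.

(** Moving one [A^t] across [h] turns [|C A^t x|^2] into the form of a single function of [A], so a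
    whole sum of squares is one value of [quad]. *)
Lemma op_power_square_sum (s : seq R) x : (forall t, t \in s -> 0 <= t) ->
  \sum_(t <- s) hnorm (C (op_power A t x)) ^+ 2 = quad (square_sum s) x.
Proof.
elim: s => [|t s IH] s0.
  rewrite big_nil; have -> : square_sum [::] = fun=> 0.
    by apply/funext => z; rewrite /square_sum big_nil.
  by rewrite /quad (calculus_cst PhiP) scale0r (linear_map0 Cb.1) inner0l.
have ct := continuous_on_power (s0 t (mem_head _ _)).
have s0' u : u \in s -> 0 <= u by move=> us; rewrite s0 // inE us orbT.
have cs := continuous_on_square_sum s0'; have ctt := continuous_onM ct ct.
have -> : square_sum (t :: s) = fun z => power_fun t z * power_fun t z + square_sum s z.
  by apply/funext => z; rewrite /square_sum big_cons rmorphD /= -rmorphM.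
rewrite big_cons IH // /quad (calculusD PhiP ctt cs) (linear_mapD Cb.1) innerDl ReD.
congr (_ + _); rewrite (calculusM PhiP ct ct).
rewrite (calculus_symmetric Ab Ap PhiP _ _ Cb CA ct).
have -> : (fun z => Num.conj (power_fun t z)) = power_fun t.
  by apply/funext => z; exact: conjc_real.
by rewrite inner_hnorm op_power_calculus.
Qed.

(** Integer powers enter as real exponents [n%:R], so the same transfer serves both comparisons
    between [T] and the natural numbers. *)
Lemma op_power_square_sum_le (s s' : seq R) (K : R) x :
  (forall t, t \in s -> 0 <= t) -> (forall t, t \in s' -> 0 <= t) ->
  (forall z, spectrum A z -> complex.Re z <= 1) ->
  (forall r, 0 <= r <= 1 ->
    \sum_(t <- s) (r `^ t) ^+ 2 <= K * \sum_(t <- s') (r `^ t) ^+ 2) ->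
  \sum_(t <- s) hnorm (C (op_power A t x)) ^+ 2 <=
  K * \sum_(t <- s') hnorm (C (op_power A t x)) ^+ 2.
Proof.
move=> s0 s'0 le1 h; rewrite !op_power_square_sum //.
have cs' := continuous_on_square_sum s'0.
have -> : K * quad (square_sum s') x = quad (fun z => K%:C * square_sum s' z) x.
  by rewrite /quad (calculusZ PhiP _ cs') (linear_mapZ Cb.1) innerZl ReZ.
apply: calculus_quad_le; first exact: continuous_on_square_sum.
  exact: continuous_onM (continuous_on_cst _ _) cs'.
move=> z sz; rewrite /square_sum -rmorphM /= lecR h //.
by rewrite spectrum_Re_ge0 // le1.
Qed.

End Powers.

Section Sufficiency.
Context {R : realType} {H Y : hilbertType R} (A : H -> H) (C : H -> Y).
Context (Ab : bounded_op A) (Ap : positive_op A) (Cb : bounded_op C).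
Let sa : is_adjoint A A := positive_op_selfadjoint Ab.1 Ap.

Lemma symmetric_of_commute :
  (forall x, A (adjoint C (C x)) - adjoint C (C (A x)) = 0) ->
  forall u v, inner (C (A u)) (C v) = inner (C u) (C (A v)).
Proof.
move=> comm u v; have adj := adjointP Cb.
have e : A (adjoint C (C v)) = adjoint C (C (A v)).
  by apply/eqP; rewrite -subr_eq0 comm.
by rewrite !adj sa e.
Qed.

(* [|A x|^2 <= |A^2 x| |x|] makes [|A^n x|] log-convex in [n]. *)
Lemma contraction_of_power_bounded (M : R) :
  (forall n x, hnorm (iter n A x) ^+ 2 <= M * hnorm x ^+ 2) ->
  forall x, hnorm (A x) <= hnorm x.
Proof.
move=> h x; rewrite leNgt; apply/negP => lt.
have logconv y : hnorm (A y) ^+ 2 <= hnorm (A (A y)) * hnorm y.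
  apply: le_trans (Re_inner_le _ _).
  have -> : inner (A (A y)) y = inner (A y) (A y) by rewrite sa.
  by rewrite inner_hnorm.
have xgt0 : 0 < hnorm x.
  rewrite lt_neqAle hnorm_ge0 andbT eq_sym; apply/negP => /eqP x0.
  by move: lt; rewrite (hnorm_eq0 x0) (linear_map0 Ab.1) ltxx.
pose rho := hnorm (A x) / hnorm x.
have rho1 : 1 < rho by rewrite ltr_pdivlMr // mul1r.
have step n : 0 < hnorm (iter n A x) /\
    rho * hnorm (iter n A x) <= hnorm (iter n.+1 A x).
  elim: n => [|n [IH0 IH]] /=; first by rewrite divfK ?lt0r_neq0.
  have p0 : 0 < hnorm (iter n.+1 A x).
    by rewrite (lt_le_trans _ IH) // mulr_gt0 // (lt_trans ltr01).
  split=> //; have := logconv (iter n A x); rewrite -iterS /= => lc.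
  rewrite -(ler_pM2r p0) -mulrA -expr2.
  apply: le_trans (ler_wpM2l (ltW (lt_trans ltr01 rho1)) lc) _.
  by rewrite mulrCA ler_wpM2l ?hnorm_ge0.
(* Bernoulli's inequality applied to [rho ^+ n]: unboundedness is all that is needed. *)
have grow n : (1 + n%:R * (rho - 1)) * hnorm x <= hnorm (iter n A x).
  apply: (@le_trans _ _ (rho ^+ n * hnorm x)); last first.
    elim: n => [|n IH]; first by rewrite expr0 mul1r.
    rewrite exprS -mulrA (le_trans _ (step n).2) // ler_wpM2l //.
    by rewrite ltW // (lt_trans ltr01).
  rewrite ler_wpM2r ?hnorm_ge0 //; elim: n => [|n IH]; first by rewrite mul0r addr0.
  rewrite exprS -natr1.
  have := ler_wpM2l (ltW (lt_trans ltr01 rho1)) IH; apply: le_trans.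
  have : 0 <= n%:R * (rho - 1) ^+ 2 by rewrite mulr_ge0 ?sqr_ge0.
  by lra.
pose n := (Num.truncn (`|M| / (rho - 1))).+1.
have r10 : 0 < rho - 1 by rewrite subr_gt0.
have nM : `|M| < n%:R * (rho - 1) by rewrite -ltr_pdivrMr // truncnS_gt.
have /(lt_le_trans _) := grow n => /(_ ((1 + `|M|) * hnorm x)).
rewrite ltr_pM2r // ltrD2l => /(_ nM) big.
have := h n x; apply/negP; rewrite -ltNge.
apply: (@le_lt_trans _ _ (((1 + `|M|) * hnorm x) ^+ 2)); last first.
  by rewrite ltr_sqr ?nnegrE ?hnorm_ge0 // mulr_ge0 ?hnorm_ge0 // addr_ge0.
rewrite exprMn ler_wpM2r ?sqr_ge0 //.
by have := ler_norm M; have := sqr_ge0 `|M|; have := normr_ge0 M; lra.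
Qed.

(** The observations of [A^m x] are a tail of those of [x], so [a |A^m x|^2 <= b |x|^2] for every
    [m]. *)
Lemma observable_contraction :
  exactly_observable [set: nat] (fun n x => C (iter n A x)) ->
  forall x, hnorm (A x) <= hnorm x.
Proof.
case=> a [b [a0 ab ob]]; apply: (@contraction_of_power_bounded (b / a)) => m x.
rewrite mulrAC ler_pdivlMr // mulrC -lee_fin.
have /andP[h1 _] := ob (iter m A x); have /andP[_ h2] := ob x.
apply: le_trans h1 _; apply: le_trans h2.
have fin : (\esum_(n in [set: nat]) (hnorm (C (iter n A x)) ^+ 2)%:E \is a fin_num)%E.
  have /andP[_ h2] := ob x; rewrite ge0_fin_numE; first by rewrite (le_lt_trans h2) ?ltry.
  by apply: esum_ge0 => n _; rewrite lee_fin sqr_ge0.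
rewrite -(fineK fin); apply: esum_le_of_sum_le => s us _; rewrite -lee_fin fineK //.
have -> : \sum_(n <- s) hnorm (C (iter n A (iter m A x))) ^+ 2 =
    \sum_(n <- map (addn^~ m) s) hnorm (C (iter n A x)) ^+ 2.
  by rewrite big_map; apply: eq_bigr => n _; rewrite iterD.
by apply: sum_le_esum => //; rewrite map_inj_uniq // => i j /addIn.
Qed.

Lemma exactly_observable_of_linear_growth (T : set R) :
  T `<=` `[0, +oo[ -> locally_finite T -> T 0 -> linear_growth T ->
  (forall x, A (adjoint C (C x)) - adjoint C (C (A x)) = 0) ->
  exactly_observable [set: nat] (fun n x => C (iter n A x)) ->
  exactly_observable T (fun t x => C (op_power A t x)).
Proof.
move=> T0 Tlf T00 Tg comm ob; have sym := symmetric_of_commute comm.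
have contr := observable_contraction ob.
have Re1 z : spectrum A z -> complex.Re z <= 1.
  by apply: (spectrum_le Ab Ap) => x; rewrite mul1r.
have Tge0 t : T t -> 0 <= t by move=> /T0; rewrite /= in_itv /= andbT.
have nat_sum N x : \sum_(t <- [seq n%:R | n <- index_iota 0 N]) hnorm (C (op_power A t x)) ^+ 2 =
    \sum_(0 <= n < N) hnorm (C (iter n A x)) ^+ 2.
  by rewrite big_map; apply: eq_bigr => n _; rewrite (op_power_nat Ab Ap).
have nat_pow N (r : R) : 0 <= r -> \sum_(t <- [seq n%:R | n <- index_iota 0 N]) (r `^ t) ^+ 2 =
    \sum_(0 <= n < N) (r ^+ n) ^+ 2.
  by move=> r0; rewrite big_map; apply: eq_bigr => n _; rewrite powR_mulrn.
have nat_ge0 N (t : R) : t \in [seq n%:R | n <- index_iota 0 N] -> 0 <= t.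
  by move=> /mapP[n _ ->].
case: ob => a [b [a0 ab ob]].
have [K K0 hK] := powers_upper T0 Tlf Tg; have [D D0 hD] := powers_lower T0 Tlf T00 Tg.
have upper x : (\esum_(t in T) (hnorm (C (op_power A t x)) ^+ 2)%:E <=
    (K%:R * b * hnorm x ^+ 2)%:E)%E.
  apply: esum_le_of_sum_le => s us sT.
  apply: (@le_trans _ _ (K%:R * \sum_(0 <= n < size s) hnorm (C (iter n A x)) ^+ 2)).
    rewrite -nat_sum; apply: op_power_square_sum_le => //; [|exact: nat_ge0|].
      by move=> t /sT/Tge0.
    by move=> r /[dup] r01 /andP[r0 _]; rewrite nat_pow // hK.
  rewrite -mulrA ler_wpM2l // -lee_fin; have /andP[_] := ob x; apply: le_trans.
  by apply: sum_le_esum; rewrite ?iota_uniq.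
exists (a / D%:R), (K%:R * b); split; first by rewrite divr_gt0 ?ltr0n.
  apply: (@le_trans _ _ a).
    by rewrite ler_pdivrMr ?ltr0n // ler_peMr ?(ltW a0) // ler1n.
  by rewrite (le_trans ab) // ler_peMl ?ler1n // (le_trans (ltW a0)).
move=> x; rewrite upper andbT.
have fin : (\esum_(t in T) (hnorm (C (op_power A t x)) ^+ 2)%:E \is a fin_num)%E.
  rewrite ge0_fin_numE; first by rewrite (le_lt_trans (upper x)) ?ltry.
  by apply: esum_ge0 => n _; rewrite lee_fin sqr_ge0.
rewrite -(fineK fin) lee_fin mulrAC ler_pdivrMr ?ltr0n // [leRHS]mulrC -lee_fin.
have /andP[h1 _] := ob x; apply: le_trans h1 _.
apply: esum_le_of_sum_le => s us _.
(* Any [J] exceeding all indices in [s] works, since then they lie below [D * J]. *)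
pose J := (\max_(n <- s) n).+1.
have [s' [us' s'T hs']] := hD J.
apply: (@le_trans _ _ (\sum_(0 <= n < D * J) hnorm (C (iter n A x)) ^+ 2)).
  apply: sum_seq_nat_le => // [n|n ns]; first exact: sqr_ge0.
  by rewrite (leq_trans _ (leq_pmull _ D0)) // /J ltnS; exact: leq_bigmax_seq.
apply: (@le_trans _ _ (D%:R * \sum_(t <- s') hnorm (C (op_power A t x)) ^+ 2)).
  rewrite -nat_sum; apply: op_power_square_sum_le => //; [exact: nat_ge0| |].
    by move=> t /s'T/Tge0.
  by move=> r /[dup] r01 /andP[r0 _]; rewrite nat_pow // hs'.
by rewrite ler_wpM2l // -lee_fin fineK // sum_le_esum.
Qed.

End Sufficiency.

(** * The Hilbert space of square-summable sequences *)

Section RealSeries.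
Context {R : realType}.
Implicit Types (w : nat -> R) (z : nat -> R[i]).

Definition summable_seq z := cvgn (series (fun n => normc (z n))).

Definition rsum w : R := limn (series w).

Definition csum z : R[i] := rsum (fun n => complex.Re (z n)) +i* rsum (fun n => complex.Im (z n)).

Lemma cvg_series_of_le w z : (forall n, `|w n| <= normc (z n)) -> summable_seq z ->
  cvgn (series w).
Proof.
move=> h sz; apply: normed_cvg; apply: series_le_cvg sz => n /=.
- exact: normr_ge0.
- exact: normc_ge0.
- exact: h.
Qed.

Lemma normr_Re_le (x : R[i]) : `|complex.Re x| <= normc x.
Proof.
rewrite -[leRHS]ger0_norm ?normc_ge0 // -ler_sqr ?nnegrE // !real_normK ?num_real //.
by rewrite normc_sqr lerDl sqr_ge0.
Qed.

Lemma normr_Im_le (x : R[i]) : `|complex.Im x| <= normc x.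
Proof.
rewrite -[leRHS]ger0_norm ?normc_ge0 // -ler_sqr ?nnegrE // !real_normK ?num_real //.
by rewrite normc_sqr lerDr sqr_ge0.
Qed.

Lemma csumP (a : R[i]) z z' : summable_seq z -> summable_seq z' ->
  csum (fun n => a * z n + z' n) = a * csum z + csum z'.
Proof.
move=> sz sz'.
have cRe := cvg_series_of_le (fun n => normr_Re_le (z n)) sz.
have cIm := cvg_series_of_le (fun n => normr_Im_le (z n)) sz.
have cRe' := cvg_series_of_le (fun n => normr_Re_le (z' n)) sz'.
have cIm' := cvg_series_of_le (fun n => normr_Im_le (z' n)) sz'.
have lin (p q : R) (u v w : nat -> R) : cvgn (series u) -> cvgn (series v) ->
    cvgn (series w) -> rsum (fun n => p * u n + q * v n + w n) =
    p * rsum u + q * rsum v + rsum w.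
  move=> cu cv cw; have cpu := @is_cvg_seriesZ _ u p cu.
  have cqv := @is_cvg_seriesZ _ v q cv.
  rewrite /rsum -[p * _](lim_seriesZ p cu) -[q * _](lim_seriesZ q cv).
  by rewrite -(lim_seriesD cpu cqv) -(lim_seriesD (is_cvg_seriesD cpu cqv) cw).
case: a => p q; rewrite /csum /=.
have -> : rsum (fun n => complex.Re ((p +i* q) * z n + z' n)) =
    rsum (fun n => p * complex.Re (z n) + - q * complex.Im (z n) + complex.Re (z' n)).
  congr rsum; apply/funext => n; case: (z n) (z' n) => a b [c d] /=; ring.
have -> : rsum (fun n => complex.Im ((p +i* q) * z n + z' n)) =
    rsum (fun n => p * complex.Im (z n) + q * complex.Re (z n) + complex.Im (z' n)).
  by congr rsum; apply/funext => n; case: (z n) (z' n) => a b [c d] /=; ring.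
by rewrite !lin // mulNr.
Qed.

Lemma csum_conj z : summable_seq z -> csum (fun n => conjc (z n)) = conjc (csum z).
Proof.
move=> sz; have cIm := cvg_series_of_le (fun n => normr_Im_le (z n)) sz.
rewrite /csum /=; congr (_ +i* _).
  by congr rsum; apply/funext => n; case: (z n).
rewrite -[RHS]mulN1r /rsum -[RHS](lim_seriesZ (-1) cIm); congr (limn (series _)).
by apply/funext => n; rewrite -[RHS]/(-1 * complex.Im (z n)) mulN1r; case: (z n).
Qed.

End RealSeries.

(** Membership is a uniform bound on partial sums, not convergence of a series, so closure under the
    vector operations is a matter of finite sums. *)
Record l2 (R : realType) := L2 {
  l2val :> nat -> R[i] ;
  l2P : exists M : R, forall N, \sum_(n < N) normc (l2val n) ^+ 2 <= M
}.

Section SquareSummable.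
Context {R : realType}.
Implicit Types (u v w : l2 R).

Lemma l2_ext u v : (forall n, u n = v n) -> u = v.
Proof.
case: u v => [u uP] [v vP] /= /funext uv; subst v; congr L2; exact: Prop_irrelevance.
Qed.

HB.instance Definition _ := gen_eqMixin (l2 R).
HB.instance Definition _ := gen_choiceMixin (l2 R).

Lemma sqr_normcD_le (a b : R[i]) :
  normc (a + b) ^+ 2 <= 2 * normc a ^+ 2 + 2 * normc b ^+ 2.
Proof.
apply: (@le_trans _ _ ((normc a + normc b) ^+ 2)).
  by rewrite ler_sqr ?nnegrE ?addr_ge0 ?normc_ge0 // le_normcD.
by have := sqr_ge0 (normc a - normc b); lra.
Qed.

Lemma l2_addP u v :
  exists M : R, forall N, \sum_(n < N) normc (u n + v n) ^+ 2 <= M.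
Proof.
case: (l2P u) (l2P v) => M hM [M' hM']; exists (2 * M + 2 * M') => N.
apply: (@le_trans _ _ (\sum_(n < N) (2 * normc (u n) ^+ 2 + 2 * normc (v n) ^+ 2))).
  by apply: ler_sum => n _; exact: sqr_normcD_le.
by rewrite big_split -!mulr_sumr lerD // ler_wpM2l.
Qed.

Lemma l2_scaleP (a : R[i]) u :
  exists M : R, forall N, \sum_(n < N) normc (a * u n) ^+ 2 <= M.
Proof.
case: (l2P u) => M hM; exists (normc a ^+ 2 * M) => N.
under eq_bigr do rewrite normcM exprMn.
by rewrite -mulr_sumr ler_wpM2l ?sqr_ge0.
Qed.

Lemma l2_oppP u : exists M : R, forall N, \sum_(n < N) normc (- u n) ^+ 2 <= M.
Proof.
by case: (l2P u) => M hM; exists M => N; under eq_bigr do rewrite normcN.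
Qed.

Lemma l2_zeroP : exists M : R, forall N, \sum_(n < N) normc (0 : R[i]) ^+ 2 <= M.
Proof. by exists 0 => N; rewrite big1 // => n _; rewrite normc0 expr0n. Qed.

Definition l2_add u v := @L2 R (fun n => u n + v n) (l2_addP u v).
Definition l2_opp u := @L2 R (fun n => - u n) (l2_oppP u).
Definition l2_zero : l2 R := @L2 R (fun=> 0) l2_zeroP.
Definition l2_scale (a : R[i]) u := @L2 R (fun n => a * u n) (l2_scaleP a u).

Lemma l2_addA : associative l2_add.
Proof. by move=> u v w; apply: l2_ext => n /=; rewrite addrA. Qed.
Lemma l2_addC : commutative l2_add.
Proof. by move=> u v; apply: l2_ext => n /=; rewrite addrC. Qed.
Lemma l2_add0 : left_id l2_zero l2_add.
Proof. by move=> u; apply: l2_ext => n /=; rewrite add0r. Qed.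
Lemma l2_addN : left_inverse l2_zero l2_opp l2_add.
Proof. by move=> u; apply: l2_ext => n /=; rewrite addNr. Qed.

HB.instance Definition _ := GRing.isZmodule.Build (l2 R) l2_addA l2_addC l2_add0 l2_addN.

Lemma l2_scaleA (a b : R[i]) u : l2_scale a (l2_scale b u) = l2_scale (a * b) u.
Proof. by apply: l2_ext => n /=; rewrite mulrA. Qed.
Lemma l2_scale1 : left_id 1 l2_scale.
Proof. by move=> u; apply: l2_ext => n /=; rewrite mul1r. Qed.
Lemma l2_scaleDr : right_distributive l2_scale +%R.
Proof. by move=> a u v; apply: l2_ext => n /=; rewrite mulrDr. Qed.
Lemma l2_scaleDl u : {morph l2_scale^~ u : a b / a + b}.
Proof. by move=> a b; apply: l2_ext => n /=; rewrite mulrDl. Qed.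

HB.instance Definition _ := GRing.Zmodule_isLmodule.Build R[i] (l2 R)
  l2_scaleA l2_scale1 l2_scaleDr l2_scaleDl.

Lemma l2_normc_summable u v : summable_seq (fun n => u n * conjc (v n)).
Proof.
apply: nondecreasing_is_cvgn.
  apply/nondecreasing_seqP => n; rewrite !seriesEnat /= big_nat_recr //= lerDl.
  exact: normc_ge0.
case: (l2P u) (l2P v) => M hM [M' hM']; exists (M + M') => _ [N _ <-].
rewrite seriesEord /=.
apply: (@le_trans _ _ (\sum_(n < N) (normc (u n) ^+ 2 + normc (v n) ^+ 2))).
  apply: ler_sum => n _; rewrite normcM normc_conj.
  have := sqr_ge0 (normc (u n) - normc (v n)).
  have := mulr_ge0 (normc_ge0 (u n)) (normc_ge0 (v n)); lra.
by rewrite big_split lerD.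
Qed.

Definition l2_inner u v : R[i] := csum (fun n => u n * conjc (v n)).

Lemma l2_inner_linearl v : scalar (l2_inner^~ v).
Proof.
move=> a u w; rewrite /l2_inner -csumP; try exact: l2_normc_summable.
by congr csum; apply/funext => n /=; rewrite mulrDl mulrA.
Qed.

Lemma l2_inner_conj u v : l2_inner u v = conjc (l2_inner v u).
Proof.
rewrite /l2_inner -csum_conj; last exact: l2_normc_summable.
by congr csum; apply/funext => n; case: (u n) (v n) => a b [c d] /=;
  congr (_ +i* _); ring.
Qed.

Lemma l2_inner_bilinear : bilinear_for
  (GRing.Scale.Law.clone _ _ *%R _) (GRing.Scale.Law.clone _ _ (Num.conj \; *%R) _)
  l2_inner.
Proof.
split; first exact: l2_inner_linearl.
move=> u a v w; rewrite ![l2_inner u _]l2_inner_conj l2_inner_linearl.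
by rewrite rmorphD rmorphM.
Qed.

HB.instance Definition _ := bilinear_isBilinear.Build R[i] (l2 R) (l2 R) R[i]
  (GRing.Scale.Law.clone _ _ *%R _) (GRing.Scale.Law.clone _ _ (Num.conj \; *%R) _)
  l2_inner l2_inner_bilinear.

Lemma l2_inner_hermitian u v : l2_inner u v = (-1) ^+ false * Num.conj (l2_inner v u).
Proof. by rewrite expr0 mul1r; exact: l2_inner_conj. Qed.

HB.instance Definition _ := @isHermitianSesquilinear.Build R[i] (l2 R) false Num.conj
  l2_inner l2_inner_hermitian.

Definition l2_normsq u : R := rsum (fun n => normc (u n) ^+ 2).

Lemma l2_inner_normsq u : l2_inner u u = (l2_normsq u)%:C.
Proof.
rewrite /l2_inner /csum /l2_normsq; congr (_ +i* _).
  by congr rsum; apply/funext => n; rewrite -sqr_normcE.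
rewrite /rsum (_ : series _ = fun=> 0) ?lim_cst //.
by apply/funext => n; rewrite seriesEord /= big1 // => i _; rewrite -sqr_normcE.
Qed.

Lemma l2_normsq_cvg u : cvgn (series (fun n => normc (u n) ^+ 2)).
Proof.
apply: nondecreasing_is_cvgn.
  apply/nondecreasing_seqP => n; rewrite !seriesEnat /= big_nat_recr //= lerDl.
  exact: sqr_ge0.
by case: (l2P u) => M hM; exists M => _ [N _ <-]; rewrite seriesEord; exact: hM.
Qed.

Lemma l2_partial_le_normsq u N : \sum_(n < N) normc (u n) ^+ 2 <= l2_normsq u.
Proof.
have nd : nondecreasing_seq (series (fun n => normc (u n) ^+ 2)).
  apply/nondecreasing_seqP => n; rewrite !seriesEnat /= big_nat_recr //= lerDl.
  exact: sqr_ge0.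
by have := nondecreasing_cvgn_le nd (@l2_normsq_cvg u) N; rewrite /series /= big_mkord.
Qed.

Lemma l2_normsq_le u (B : R) : (forall N, \sum_(n < N) normc (u n) ^+ 2 <= B) ->
  l2_normsq u <= B.
Proof.
move=> h; apply: limr_le; first exact: l2_normsq_cvg.
by apply: nearW => N; rewrite seriesEord; exact: h.
Qed.

Lemma l2_coord_le_normsq u k : normc (u k) ^+ 2 <= l2_normsq u.
Proof.
apply: le_trans (l2_partial_le_normsq u k.+1); rewrite big_ord_recr /= lerDr.
by apply: sumr_ge0 => i _; exact: sqr_ge0.
Qed.

Lemma l2_normsq_ge0 u : 0 <= l2_normsq u.
Proof. by have := l2_partial_le_normsq u 0; rewrite big_ord0. Qed.

Lemma l2_normsq_eq0 u : l2_normsq u = 0 -> u = 0.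
Proof.
move=> h; apply: l2_ext => k /=; apply: eq0_normc; apply/eqP.
by rewrite -sqrf_eq0 eq_le sqr_ge0 andbT -h l2_coord_le_normsq.
Qed.

Lemma l2_inner_gt0 u : u != 0 -> 0 < l2_inner u u.
Proof.
move=> un0; rewrite l2_inner_normsq ltcR lt_neqAle l2_normsq_ge0 andbT eq_sym.
by apply: contra un0 => /eqP/l2_normsq_eq0/eqP.
Qed.

HB.instance Definition _ := @isDotProduct.Build R[i] (l2 R) l2_inner l2_inner_gt0.

Definition l2_norm u : R[i] := (Num.sqrt (l2_normsq u))%:C.

Lemma l2_normsqZ (a : R[i]) u : l2_normsq (a *: u) = normc a ^+ 2 * l2_normsq u.
Proof.
rewrite /l2_normsq /rsum -[RHS](lim_seriesZ _ (@l2_normsq_cvg u)).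
congr (limn (series _)); apply/funext => n.
by rewrite -[RHS]/(normc a ^+ 2 * normc (u n) ^+ 2) -exprMn -normcM.
Qed.

Lemma l2_normsq_translate (t : R) u v : l2_normsq (t%:C *: v + u) =
  l2_normsq u + 2 * complex.Re (l2_inner u v) * t + l2_normsq v * t ^+ 2.
Proof.
have lin a w w' x : l2_inner (a *: w + w') x = a * l2_inner w x + l2_inner w' x.
  exact: l2_inner_linearl.
have e w : l2_normsq w = complex.Re (l2_inner w w) by rewrite l2_inner_normsq.
rewrite (e (_ + _)) lin ![l2_inner _ (_ + _)]l2_inner_conj !lin !l2_inner_normsq.
rewrite [l2_inner v u]l2_inner_conj.
case: (l2_inner u v) => a b /=; ring.
Qed.

(** Cauchy-Schwarz has to be proved here from [l2_normsq], because the triangle inequality it yields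
    is needed to build the Hilbert structure. *)
Lemma l2_Re_inner_le u v :
  complex.Re (l2_inner u v) <= Num.sqrt (l2_normsq u) * Num.sqrt (l2_normsq v).
Proof.
have [r0|r0] := leP (complex.Re (l2_inner u v)) 0.
  by rewrite (le_trans r0) // mulr_ge0 ?sqrtr_ge0.
rewrite -ler_sqr ?nnegrE ?mulr_ge0 ?sqrtr_ge0 ?(ltW r0) // exprMn.
rewrite !sqr_sqrtr ?l2_normsq_ge0 //.
apply: le_sq_of_quadratic_ge0 => [|t]; first exact: l2_normsq_ge0.
by rewrite -l2_normsq_translate l2_normsq_ge0.
Qed.

Lemma ler_l2_normD u v : l2_norm (u + v) <= l2_norm u + l2_norm v.
Proof.
rewrite /l2_norm -rmorphD lecR -ler_sqr ?nnegrE ?addr_ge0 ?sqrtr_ge0 //.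
have := l2_normsq_translate 1 u v; rewrite scale1r addrC => e.
rewrite sqrrD !sqr_sqrtr ?l2_normsq_ge0 // e.
by have := l2_Re_inner_le u v; lra.
Qed.

Lemma l2_normZ (a : R[i]) u : l2_norm (a *: u) = `|a| * l2_norm u.
Proof.
rewrite /l2_norm l2_normsqZ sqrtrM ?sqr_ge0 // sqrtr_sqr ger0_norm ?normc_ge0 //.
by rewrite rmorphM.
Qed.

Lemma l2_norm_eq0 u : l2_norm u = 0 -> u = 0.
Proof.
case=> /eqP; rewrite sqrtr_eq0 => h; apply: l2_normsq_eq0; apply/le_anti.
by rewrite h l2_normsq_ge0.
Qed.

HB.instance Definition _ := Lmodule_isNormed.Build R[i] (l2 R)
  ler_l2_normD l2_normZ l2_norm_eq0.

Lemma l2_normE u : `|u| = (Num.sqrt (l2_normsq u))%:C.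
Proof. by []. Qed.

(** The limit is taken coordinatewise. A finite partial sum of squared distances passes to the
    limit, with a bound independent of its length, which gives both square-summability and norm
    convergence. *)
Lemma l2_complete (F : set_system (l2 R)) : ProperFilter F -> cauchy F -> cvg F.
Proof.
move=> PF /cauchyP cF.
have small (e : R) : 0 < e -> exists x, F [set u | l2_normsq (u - x) <= e ^+ 2].
  move=> e0; have [x Fx] := cF e%:C (etrans (ltcR _ _) e0); exists x.
  apply: filterS Fx => u; rewrite -ball_normE /ball_ /= l2_normE ltcR => h.
  have -> : l2_normsq (u - x) = l2_normsq (x - u).
    by rewrite -[u - x]opprB -scaleN1r l2_normsqZ normcN normc1 expr1n mul1r.
  rewrite -(sqr_sqrtr (l2_normsq_ge0 (x - u))).
  by rewrite ler_sqr ?nnegrE ?sqrtr_ge0 ?(ltW e0) // ltW.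
have coordcvg (phi : R[i] -> R) n : (forall a b, `|phi a - phi b| <= normc (a - b)) ->
    cvg ((fun u : l2 R => phi (u n)) @ F).
  move=> hphi; apply: R_complete; apply: cauchy_exP => e e0.
  have e20 : 0 < e / 2 by rewrite divr_gt0.
  have [x Fx] := small _ e20; exists (phi (x n)).
  suff : F [set u | ball (phi (x n)) e (phi (u n))] by [].
  apply: filterS Fx => u /= ux; rewrite -ball_normE /ball_ /= distrC.
  apply: (le_lt_trans (hphi _ _)); apply: (@le_lt_trans _ _ (e / 2)).
    rewrite -ler_sqr ?nnegrE ?normc_ge0 ?(ltW e20) //; apply: le_trans ux.
    exact: (l2_coord_le_normsq (u - x) n).
  by rewrite gtr_pMr // invf_lt1 ?ltr1n.
have hRe (a b : R[i]) : `|complex.Re a - complex.Re b| <= normc (a - b).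
  by rewrite -ReN -ReD normr_Re_le.
have hIm (a b : R[i]) : `|complex.Im a - complex.Im b| <= normc (a - b).
  have -> : complex.Im a - complex.Im b = complex.Im (a - b) by case: a b => ? ? [].
  exact: normr_Im_le.
have cRe n := coordcvg _ n hRe; have cIm n := coordcvg _ n hIm.
pose l n : R[i] := lim ((fun u : l2 R => complex.Re (u n)) @ F) +i*
  lim ((fun u : l2 R => complex.Im (u n)) @ F).
have close (e : R) x N : F [set u | l2_normsq (u - x) <= e ^+ 2] ->
    \sum_(n < N) normc (l n - x n) ^+ 2 <= e ^+ 2.
  move=> Fx; pose g (u : l2 R) := \sum_(n < N) ((complex.Re (u n) - complex.Re (x n)) ^+ 2 +
    (complex.Im (u n) - complex.Im (x n)) ^+ 2).
  have gl : g u @[u --> F] --> \sum_(n < N) normc (l n - x n) ^+ 2.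
    apply: cvg_big => [|n _]; first exact: add_continuous.
    rewrite normc_sqr; have -> : complex.Im (l n - x n) = complex.Im (l n) - complex.Im (x n).
      by case: (l n) (x n) => ? ? [].
    rewrite ReD ReN; apply: cvgD; apply: cvgM; apply: cvgB; try exact: cvg_cst.
    - exact: cRe.
    - exact: cRe.
    - exact: cIm.
    - exact: cIm.
  apply: (cvgr_to_le gl); apply: filterS Fx => u /= h; apply: le_trans h.
  apply: le_trans (l2_partial_le_normsq (u - x) N); apply: ler_sum => n _.
  rewrite -[(u - x) n]/(u n - x n); case: (u n) (x n) => a b [c d] /=.
  by rewrite sqr_sqrtr // addr_ge0 ?sqr_ge0.
have lP : exists M, forall N, \sum_(n < N) normc (l n) ^+ 2 <= M.
  have [x Fx] := small 1 ltr01; have [M hM] := l2P x.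
  exists (2 * 1 ^+ 2 + 2 * M) => N.
  apply: (@le_trans _ _ (\sum_(n < N) (2 * normc (l n - x n) ^+ 2 + 2 * normc (x n) ^+ 2))).
    by apply: ler_sum => n _; rewrite -{1}(subrK (x n) (l n)) sqr_normcD_le.
  by rewrite big_split -!mulr_sumr lerD // ler_wpM2l // close.
apply/cvg_ex; exists (L2 lP); apply/cvg_ballP => e e0.
have [r r0 ->] : exists2 r : R, 0 < r & e = r%:C.
  by exists (complex.Re e); rewrite -?ltcR RRe_real // gtr0_real.
have r40 : 0 < r / 4 by rewrite divr_gt0.
have [x Fx] := small _ r40; apply: filterS (Fx) => u ux.
rewrite -ball_normE /ball_ /=.
apply: (@le_lt_trans _ _ (`|L2 lP - x| + `|x - u|)).
  by rewrite -{1}(subrK x (L2 lP)) -addrA ler_normD.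
rewrite (distrC x u) !l2_normE -rmorphD ltcR.
have bound (w : l2 R) : l2_normsq w <= (r / 4) ^+ 2 -> Num.sqrt (l2_normsq w) <= r / 4.
  move=> h; rewrite -ler_sqr ?nnegrE ?sqrtr_ge0 ?(ltW r40) //.
  by rewrite sqr_sqrtr ?l2_normsq_ge0.
apply: le_lt_trans (lerD (bound _ _) (bound _ ux)) _; last by lra.
by apply: l2_normsq_le => N; exact: close.
Qed.

HB.instance Definition _ := Uniform_isComplete.Build (l2 R) l2_complete.

Lemma l2_normr_inner u : `|u| ^+ 2 = l2_inner u u.
Proof.
by rewrite l2_normE l2_inner_normsq -rmorphXn /= sqr_sqrtr ?l2_normsq_ge0.
Qed.

HB.instance Definition _ := @CompleteNormedModule_isHilbert.Build R (l2 R)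
  l2_inner l2_normr_inner.

End SquareSummable.

(** * Diagonal operators *)

Section SequenceSpace.
Context {R : realType}.
Implicit Types (u v : l2 R).

Lemma l2_hnorm_sqr u : hnorm u ^+ 2 = l2_normsq u.
Proof. by rewrite /hnorm l2_normE /= sqr_sqrtr ?l2_normsq_ge0. Qed.

Lemma l2_innerE u v : inner u v = l2_inner u v.
Proof. by []. Qed.

Lemma sum_sqr_delta (k N : nat) :
  \sum_(n < N) normc ((nat_of_ord n == k)%:R : R[i]) ^+ 2 = (k < N)%N%:R.
Proof.
elim: N => [|N IH]; first by rewrite big_ord0.
rewrite big_ord_recr IH /= ltnS (leq_eqVlt k) (eq_sym k).
have [->|_] := eqVneq N k; first by rewrite ltnn normc1 expr1n add0r.
by rewrite normc0 expr0n addr0.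
Qed.

Lemma l2_basisP (k : nat) : exists M : R, forall N,
  \sum_(n < N) normc ((nat_of_ord n == k)%:R : R[i]) ^+ 2 <= M.
Proof. by exists 1 => N; rewrite sum_sqr_delta lern1 leq_b1. Qed.

Definition l2_basis k : l2 R := @L2 R (fun n => (n == k)%:R) (l2_basisP k).

Lemma l2_basis_norm k : hnorm (l2_basis k) = 1.
Proof.
apply/eqP; rewrite -(eqrXn2 (n := 2)) ?hnorm_ge0 // expr1n l2_hnorm_sqr eq_le.
apply/andP; split; last first.
  by have := l2_coord_le_normsq (l2_basis k) k; rewrite /= eqxx normc1 expr1n.
by apply: l2_normsq_le => N; rewrite sum_sqr_delta lern1 leq_b1.
Qed.

Lemma l2_finite_sumE N (f : nat -> R[i]) n :
  (\sum_(k < N) f k *: l2_basis k : l2 R) n = if (n < N)%N then f n else 0.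
Proof.
elim: N => [|N IH]; first by rewrite big_ord0.
rewrite big_ord_recr /= -[LHS]/((\sum_(k < N) f k *: l2_basis k : l2 R) n + f N * (n == N)%:R).
rewrite IH ltnS (leq_eqVlt n); case: (ltngtP n N) => [h|h|->] /=.
- by rewrite mulr0 addr0.
- by rewrite mulr0 addr0.
- by rewrite mulr1 add0r.
Qed.

Lemma l2_truncation_dist u N (f : nat -> R[i]) :
  l2_normsq (u - \sum_(k < N) f k *: l2_basis k) <=
  \sum_(n < N) normc (u n - f n) ^+ 2 + (l2_normsq u - \sum_(n < N) normc (u n) ^+ 2).
Proof.
apply: l2_normsq_le => N'; set w := u - _.
apply: (@le_trans _ _ (\sum_(n < N + N') normc (w n) ^+ 2)).
  rewrite -!(big_mkord xpredT (fun n => normc (w n) ^+ 2)).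
  rewrite [leRHS](@big_cat_nat _ _ _ N') ?leq_addl //= lerDl.
  by apply: sumr_ge0 => n _; exact: sqr_ge0.
have wE n : w n = u n - (if (n < N)%N then f n else 0).
  by rewrite -l2_finite_sumE.
move: w wE => w wE; rewrite big_split_ord /= lerD //.
  by apply: ler_sum => n _; rewrite wE ltn_ord.
rewrite lerBrDl; apply: le_trans (l2_partial_le_normsq u (N + N')).
rewrite big_split_ord /= lerD2l; apply: ler_sum => n _.
by rewrite wE /= ltnNge leq_addr subr0.
Qed.

Lemma l2_tail u (e : R) : 0 < e ->
  exists N, l2_normsq u - \sum_(n < N) normc (u n) ^+ 2 <= e.
Proof.
move=> e0; apply: contrapT => no.
have : l2_normsq u <= l2_normsq u - e.
  apply: l2_normsq_le => N; rewrite lerBrDr -lerBrDl leNgt; apply/negP => h.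
  by apply: no; exists N; rewrite ltW.
by rewrite lerBrDl gerDr leNgt e0.
Qed.

Lemma rat_complex_approx (z : R[i]) (e : R) : 0 < e ->
  exists q : rat * rat, normc (z - (ratr q.1 +i* ratr q.2)) ^+ 2 <= e.
Proof.
move=> e0; pose d := Num.min 1 (e / 2).
have d0 : 0 < d by rewrite lt_min ltr01 divr_gt0.
have d1 : d ^+ 2 <= e / 2.
  apply: (@le_trans _ _ d); last by rewrite ge_min lexx orbT.
  by rewrite expr2 ger_pMr // ge_min lexx.
have app (r : R) : exists q : rat, (r - ratr q) ^+ 2 <= e / 2.
  have [|q] := @rat_in_itvoo R (r - d) (r + d); first by lra.
  rewrite in_itv /= => /andP[h1 h2]; exists q; apply: le_trans d1.
  rewrite -[leLHS]real_normK ?num_real // ler_sqr ?nnegrE ?(ltW d0) //.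
  by rewrite ler_norml; apply/andP; split; lra.
case: z => a b; have [p hp] := app a; have [q hq] := app b.
by exists (p, q); rewrite normc_sqr /= [leRHS]splitr lerD.
Qed.

Lemma l2_separable : separable_space (l2 R).
Proof.
pose val (s : seq (rat * rat)) (k : nat) : R[i] :=
  ratr (nth 0 s k).1 +i* ratr (nth 0 s k).2.
pose vec (s : seq (rat * rat)) : l2 R := \sum_(k < size s) val s k *: l2_basis k.
exists (range vec).
  by apply: (@sub_countable _ _ _ [set: seq (rat * rat)]); [exact: card_image_le|exact: countableP].
move=> O [u Ou] oO; have := open_nbhs_nbhs (conj oO Ou) => /nbhs_ballP[e /= e0 hO].
have [r r0 eE] : exists2 r : R, 0 < r & e = r%:C.
  by exists (complex.Re e); rewrite -?ltcR RRe_real // gtr0_real.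
have r20 : 0 < r ^+ 2 / 4 by rewrite divr_gt0 ?exprn_gt0.
have [N hN] := l2_tail u r20.
(* Half of the budget [r ^+ 2 / 2] goes to the tail, the other half is shared by [N] coordinates;
   [N.+1] also covers [N = 0]. *)
have rN : 0 < r ^+ 2 / 4 / N.+1%:R by rewrite divr_gt0 ?ltr0n.
have /choice[q hq] n := rat_complex_approx (u n) rN.
pose s := mkseq q N.
have vecE : vec s = \sum_(k < N) (ratr (q k).1 +i* ratr (q k).2) *: l2_basis k.
  by rewrite /vec size_mkseq; apply: eq_bigr => k _; rewrite /val nth_mkseq.
exists (vec s); split; last by exists s.
apply: hO; rewrite -ball_normE /ball_ /= eE hnormE ltcR.
rewrite -ltr_sqr ?nnegrE ?hnorm_ge0 ?(ltW r0) // l2_hnorm_sqr vecE.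
apply: le_lt_trans (@l2_truncation_dist u N (fun k => ratr (q k).1 +i* ratr (q k).2)) _.
apply: (@le_lt_trans _ _ (r ^+ 2 / 4 + r ^+ 2 / 4)); last first.
  by have := exprn_gt0 2 r0; lra.
apply: lerD hN; apply: (@le_trans _ _ (\sum_(n < N) (r ^+ 2 / 4 / N.+1%:R))).
  by apply: ler_sum => n _; exact: hq.
rewrite sumr_const card_ord -[leLHS]mulr_natr mulrAC ler_pdivrMr ?ltr0n //.
by rewrite ler_wpM2l ?(ltW r20) // ler_nat.
Qed.

Definition unit_weight (d : nat -> R) := forall n, 0 <= d n <= 1.

Lemma l2_diagP (d : nat -> R) (d01 : unit_weight d) u :
  exists M : R, forall N, \sum_(n < N) normc ((d n)%:C * u n) ^+ 2 <= M.
Proof.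
case: (l2P u) => M hM; exists M => N; apply: le_trans (hM N).
apply: ler_sum => n _; have /andP[d0 d1] := d01 n.
rewrite ler_sqr ?nnegrE ?normc_ge0 // normcM normc_real ger0_norm //.
by rewrite ler_piMl ?normc_ge0.
Qed.

Definition l2_diag (d : nat -> R) (d01 : unit_weight d) u : l2 R :=
  @L2 R (fun n => (d n)%:C * u n) (l2_diagP d01 u).

Lemma l2_diag_linear (d : nat -> R) (d01 : unit_weight d) : linear (l2_diag d01).
Proof.
move=> a u v; apply: l2_ext => n.
rewrite -[RHS]/(a * ((d n)%:C * u n) + (d n)%:C * v n).
by rewrite -[LHS]/((d n)%:C * (a * u n + v n)) mulrDr mulrCA.
Qed.

Lemma l2_diag_selfadjoint (d : nat -> R) (d01 : unit_weight d) :
  is_adjoint (l2_diag d01) (l2_diag d01).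
Proof.
move=> u v; rewrite !l2_innerE /l2_inner; congr csum; apply/funext => n /=.
by case: (u n) (v n) => a b [c e] /=; congr (_ +i* _); ring.
Qed.

Lemma l2_diag_bounded (d : nat -> R) (d01 : unit_weight d) : bounded_op (l2_diag d01).
Proof.
split; first exact: l2_diag_linear.
exists 1 => u; rewrite mul1r -ler_sqr ?nnegrE ?hnorm_ge0 // !l2_hnorm_sqr.
apply: l2_normsq_le => N; apply: le_trans (l2_partial_le_normsq u N).
apply: ler_sum => n _ /=; have /andP[d0 d1] := d01 n.
rewrite ler_sqr ?nnegrE ?normc_ge0 // normcM normc_real ger0_norm //.
by rewrite ler_piMl ?normc_ge0.
Qed.

Lemma l2_diag_positive (d : nat -> R) (d01 : unit_weight d) : positive_op (l2_diag d01).
Proof.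
have sd01 : unit_weight (fun n => Num.sqrt (d n)).
  move=> n; have /andP[d0 d1] := d01 n; rewrite sqrtr_ge0 /=.
  by rewrite -[leRHS](@sqrtr1 R) ler_sqrt.
move=> u; have -> : l2_diag d01 u = l2_diag sd01 (l2_diag sd01 u).
  apply: l2_ext => n /=; have /andP[d0 d1] := d01 n.
  by rewrite mulrA -rmorphM /= -expr2 sqr_sqrtr.
by rewrite l2_diag_selfadjoint inner_hnorm ler0c sqr_ge0.
Qed.

Lemma l2_diag_basis (d : nat -> R) (d01 : unit_weight d) k :
  l2_diag d01 (l2_basis k) = (d k)%:C *: l2_basis k.
Proof.
apply: l2_ext => n; rewrite -[RHS]/((d k)%:C * (n == k)%:R) /=.
by have [->//|_] := eqVneq n k; rewrite !mulr0.
Qed.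

Lemma l2_diag_iter (d : nat -> R) (d01 : unit_weight d) m u n :
  (iter m (l2_diag d01) u) n = (d n ^+ m)%:C * u n.
Proof.
elim: m => [|m IH]; first by rewrite expr0 mul1r.
by rewrite iterS -[LHS]/((d n)%:C * (iter m (l2_diag d01) u) n) IH exprS rmorphM mulrA.
Qed.

Section DiagonalPair.
Context (lam : nat -> R) (lam01 : unit_weight lam).

Definition colam n : R := Num.sqrt (1 - lam n ^+ 2).

Lemma sqr_lam_le1 n : lam n ^+ 2 <= 1.
Proof. by have /andP[l0 l1] := lam01 n; rewrite expr_le1. Qed.

Lemma sqr_colam n : colam n ^+ 2 = 1 - lam n ^+ 2.
Proof. by rewrite sqr_sqrtr // subr_ge0 sqr_lam_le1. Qed.

Lemma colam01 : unit_weight colam.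
Proof.
move=> n; rewrite sqrtr_ge0 /= -[leRHS](@sqrtr1 R) ler_sqrt //.
by rewrite gerBl sqr_ge0.
Qed.

Local Notation A := (l2_diag lam01).
Local Notation C := (l2_diag colam01).

Lemma diag_pair_commute u : A (adjoint C (C u)) - adjoint C (C (A u)) = 0.
Proof.
have adjC v : adjoint C v = C v.
  apply: inner_ext => w; rewrite innerC -(adjointP (l2_diag_bounded colam01)) -innerC.
  by rewrite l2_diag_selfadjoint.
apply/eqP; rewrite subr_eq0 !adjC; apply/eqP/l2_ext => n /=.
by rewrite !(mulrCA (lam n)%:C).
Qed.

(** Taken at [iter n A u], it makes the observation sum telescope. *)
Lemma diag_pair_partition u :
  hnorm (C u) ^+ 2 + hnorm (A u) ^+ 2 = hnorm u ^+ 2.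
Proof.
apply: complexI; rewrite rmorphD /= -!inner_hnorm !l2_diag_selfadjoint -innerDr.
congr (inner _ _); apply: l2_ext => n.
rewrite -[LHS]/((colam n)%:C * ((colam n)%:C * u n) + (lam n)%:C * ((lam n)%:C * u n)).
by rewrite !mulrA -!rmorphM /= -!expr2 sqr_colam -mulrDl -rmorphD subrK mul1r.
Qed.

(** Telescoping gives the upper bound. For the lower one, the first [M] observations are restricted
    to the first [M] coordinates: the geometric sums [1 - lam k ^+ (2 * M)] are at least one half by
    hypothesis, so no limit of [|A^N u|] has to be computed. *)
Lemma diag_pair_observable :
  (forall k n, (k < n)%N -> lam k ^+ (2 * n) <= 2^-1) ->
  exactly_observable [set: nat] (fun n x => C (iter n A x)).
Proof.
move=> half; exists 2^-1, 1; split; [by []|by rewrite invf_le1 ?ler1n|move=> u].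
apply/andP; split; last first.
  rewrite mul1r; apply: esum_le_of_sum_le => s us _.
  apply: (@le_trans _ _ (\sum_(0 <= n < (\max_(n <- s) n).+1) hnorm (C (iter n A u)) ^+ 2)).
    apply: sum_seq_nat_le => // [n|n ns]; first exact: sqr_ge0.
    by rewrite ltnS; exact: leq_bigmax_seq.
  suff -> N : \sum_(0 <= n < N) hnorm (C (iter n A u)) ^+ 2 =
      hnorm u ^+ 2 - hnorm (iter N A u) ^+ 2 by rewrite gerBl sqr_ge0.
  elim: N => [|N IH]; first by rewrite big_geq // subrr.
  by rewrite big_nat_recr //= IH -[hnorm (iter N A u) ^+ 2]diag_pair_partition; ring.
suff h M : ((2^-1 * \sum_(k < M) normc (u k) ^+ 2)%:E <=
    \esum_(n in [set: nat]) (hnorm (C (iter n A u)) ^+ 2)%:E)%E.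
  have [/fineK fin|] := boolP (\esum_(n in [set: nat]) (hnorm (C (iter n A u)) ^+ 2)%:E
      \is a fin_num)%E; last first.
    rewrite ge0_fin_numE; last by apply: esum_ge0 => n _; rewrite lee_fin sqr_ge0.
    by rewrite -leNgt leye_eq => /eqP ->; exact: leey.
  rewrite -fin lee_fin ler_pdivrMl // l2_hnorm_sqr; apply: l2_normsq_le => M.
  by rewrite -ler_pdivrMl // -lee_fin fin.
apply: le_trans (@sum_le_esum R nat [set: nat] _ (index_iota 0 M) (iota_uniq _ _) (fun _ _ => I)).
rewrite lee_fin.
apply: (@le_trans _ _ (\sum_(0 <= n < M) \sum_(k < M)
    (1 - lam k ^+ 2) * lam k ^+ (2 * n) * normc (u k) ^+ 2)); last first.
  apply: ler_sum => n _; rewrite l2_hnorm_sqr.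
  apply: le_trans (l2_partial_le_normsq _ M); apply: ler_sum => k _.
  rewrite -[(C _) k]/((colam k)%:C * (iter n A u) k) l2_diag_iter !normcM !exprMn.
  by rewrite !normc_real !real_normK ?num_real // sqr_colam -exprM mulnC mulrA.
rewrite exchange_big /= mulr_sumr; apply: ler_sum => k _.
rewrite -mulr_suml ler_wpM2r ?sqr_ge0 //.
have geom (x : R) m : \sum_(0 <= n < m) (1 - x ^+ 2) * x ^+ (2 * n) = 1 - x ^+ (2 * m).
  elim: m => [|m IH]; first by rewrite big_geq // muln0 expr0 subrr.
  by rewrite big_nat_recr //= IH mulnS exprD; ring.
rewrite geom.
by have := half k M (ltn_ord k); lra.
Qed.

End DiagonalPair.

End SequenceSpace.

(** * Linear growth is necessary *)

Section Eigenvectors.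
Context {R : realType} {H : hilbertType R} (A : H -> H).
Context (Ab : bounded_op A) (Ap : positive_op A).

(** For [e] nonzero, [mu] lies in the spectrum, so a polynomial close to the power function there is
    close to it at [mu], and polynomials act on [e] by evaluation at [mu]. *)
Lemma op_power_eigenvector (mu t : R) (e : H) : 0 <= t ->
  A e = mu%:C *: e -> op_power A t e = (mu `^ t)%:C *: e.
Proof.
move=> t0 Ae; have [->|en0] := eqVneq e 0.
  rewrite op_power_calculus // scaler0; apply: linear_map0.
  by apply: (calculus_bounded (continuous_calculusP Ab Ap) _).1; exact: continuous_on_power.
have smu : spectrum A mu%:C.
  move=> [B [[lB _] BA _]]; have := BA e; rewrite Ae subrr (linear_map0 lB).
  by move/eqP; rewrite eq_sym (negbTE en0).
rewrite op_power_calculus //; apply/eqP; rewrite -subr_eq0; apply/eqP/hnorm_eq0/le_anti.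
rewrite hnorm_ge0 andbT; apply: (@ler_of_forall_mulr _ _ _ (2 * hnorm e)).
  by rewrite mulr_ge0 ?hnorm_ge0.
move=> d d0; rewrite add0r; have cf := continuous_on_power Ab Ap t0.
have [p fp] := spectrum_polynomial_approximation Ab Ap cf d0.
have pe : poly_op A p e = p.[mu%:C] *: e.
  elim/poly_ind: (p) => [|q c IH]; first by rewrite -[0]/(0%:P) poly_opC hornerC.
  by rewrite poly_opD poly_opMX poly_opC Ae (linear_mapZ (poly_op_linear q Ab.1)) IH
    hornerMXaddC scalerDl scalerA mulrC.
have h1 := calculus_dist (continuous_calculusP Ab Ap) e cf (ltW d0) fp.
rewrite (le_trans (ler_hnorm_dist _ _ (poly_op A p e))) //.
have h2 : hnorm (poly_op A p e - (mu `^ t)%:C *: e) <= d * hnorm e.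
  by rewrite pe -scalerBl hnormZ ler_wpM2r ?hnorm_ge0 // normcB; exact: fp.
by lra.
Qed.

End Eigenvectors.

Section Necessity.
Context {R : realType} (T : set R).
Context (T0 : T `<=` `[0, +oo[) (Tlf : locally_finite T).

Let T_ge0 t : T t -> 0 <= t.
Proof. by move=> /T0; rewrite /= in_itv /= andbT. Qed.

(* Both hypotheses express [sum_(t in T) exp (- 2 t / k) ~ k]. The lower bound on
   the counting function comes from splitting the sum at [t = L k], the part
   beyond being at most [exp (- L)] times the sum for [2 k]. *)
Lemma linear_growth_of_exp_sums (a b : R) : 0 < a -> 0 < b ->
  (forall (k : nat) (s : seq R), (0 < k)%N -> uniq s -> (forall t, t \in s -> T t) ->
    \sum_(t <- s) expR (- (2 * t / k%:R)) <= b * k%:R) ->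
  (forall (k : nat) (B : R), (0 < k)%N ->
    (forall s : seq R, uniq s -> (forall t, t \in s -> T t) ->
      \sum_(t <- s) expR (- (2 * t / k%:R)) <= B) -> a * k%:R <= B) ->
  linear_growth T.
Proof.
move=> a0 b0 upper lower.
(* Since [exp L >= L], this makes the far part [exp (- L) * 2 b k] at most half of the lower bound
   [a k]. *)
pose L := (Num.truncn (4 * b / a)).+1.
have L0 : 0 < L%:R :> R by rewrite ltr0n.
have hL : 4 * b / a <= L%:R by rewrite ltW // truncnS_gt.
have eL : expR (- L%:R) * (2 * b) <= a / 2.
  rewrite expRN mulrC ler_pdivrMr ?expR_gt0 //.
  apply: (@le_trans _ _ (a / 2 * L%:R)).
    by move: hL; rewrite ler_pdivrMr //; lra.
  rewrite ler_wpM2l ?divr_ge0 ?(ltW a0) //.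
  by apply: le_trans (expR_ge1Dx _); rewrite lerDr.
pose e2 : R := expR 2.
(* Lower constant: the count is at least [a k / 2] with [r <= 2 L k]. Upper constant: at most
   [b k exp 2] with [k <= 2 r]. The maximum secures the order of the two. *)
exists (a / (4 * L%:R)), (Num.max (a / (4 * L%:R)) (2 * b * e2)), (Num.max 1 L%:R).
split; [|by rewrite le_max lexx|by rewrite lt_max ltr01|].
  by rewrite divr_gt0 ?mulr_gt0.
move=> r; rewrite ge_max => /andP[r1 rL]; have r0 : 0 < r by exact: lt_le_trans r1.
apply/andP; split; last first.
  (* With [r <= k], each point of [T] up to [r] contributes at least [exp (- 2)]. *)
  pose k := (Num.truncn r).+1; pose s := enum_fset (fset_set (T `&` `[0, r])).
  have sP t : t \in s -> T t /\ t <= r.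
    by rewrite /s in_fset_set ?inE /=; [rewrite in_itv /= => -[Tt /andP[_ tr]]|exact: Tlf].
  have k0 : 0 < k%:R :> R by rewrite ltr0n.
  have rk : r <= k%:R by rewrite ltW // truncnS_gt.
  have kr : k%:R <= 2 * r.
    have /andP[h _] := truncn_itv (ltW r0); rewrite /k -natr1; lra.
  have := upper k s isT (fset_uniq _) (fun t ts => (sP t ts).1).
  have : \sum_(t <- s) e2^-1 <= \sum_(t <- s) expR (- (2 * t / k%:R)).
    rewrite big_seq [leRHS]big_seq; apply: ler_sum => t /sP[Tt tr].
    rewrite /e2 -expRN ler_expR lerN2 ler_pdivrMr // ler_pM2l //.
    exact: le_trans rk.
  rewrite big_const_seq count_predT iter_addr_0 -[_ *+ _]mulr_natl => h1 h2.
  have h3 := le_trans h1 h2; rewrite ler_pdivrMr ?expR_gt0 // in h3.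
  apply: le_trans h3 _; apply: (@le_trans _ _ (2 * b * e2 * r)); last first.
    by rewrite ler_wpM2r ?(ltW r0) // le_max lexx orbT.
  have -> : 2 * b * e2 * r = b * (2 * r) * e2 by ring.
  by rewrite ler_wpM2r ?expR_ge0 // ler_wpM2l // ltW.
(* Chosen so that [L k <= r < L (k + 1)]; [r >= L] gives [k >= 1], whence [k + 1 <= 2 k]. *)
pose k := Num.truncn (r / L%:R).
have rL1 : 1 <= r / L%:R by rewrite ler_pdivlMr // mul1r.
have /andP[kr rk] := truncn_itv (le_trans ler01 rL1); rewrite -/k in kr rk.
have k0 : (0 < k)%N.
  by rewrite -ltnS -(ltr_nat R) (le_lt_trans rL1).
have k0R : 0 < k%:R :> R by rewrite ltr0n.
have kk : k.+1%:R <= 2 * k%:R :> R by rewrite -natrM ler_nat mul2n -addnn -addn1 leq_add2l.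
have Lk0 : 0 < L%:R * k%:R :> R by rewrite mulr_gt0.
have Lkr : L%:R * k%:R <= r by rewrite mulrC -ler_pdivlMr.
have low : a * k%:R <= (counting_function T (L%:R * k%:R))%:R + a / 2 * k%:R.
  apply: (lower k) => // s us sT; rewrite (bigID (fun t => t <= L%:R * k%:R)) /=.
  rewrite lerD //.
    rewrite -big_filter; apply: (@le_trans _ _ (size [seq t <- s | t <= L%:R * k%:R])%:R).
      set s' := [seq t <- s | _].
      have -> : (size s')%:R = \sum_(t <- s') 1 :> R.
        by rewrite big_const_seq count_predT iter_addr_0.
      rewrite big_seq [leRHS]big_seq; apply: ler_sum => t.
      rewrite mem_filter => /andP[_ /sT/T_ge0 t0].
      by rewrite -[leRHS]expR0 ler_expR oppr_le0 divr_ge0 ?mulr_ge0.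
    rewrite ler_nat; apply: size_le_counting => //; first exact: filter_uniq.
    by move=> t; rewrite mem_filter => /andP[tr /sT].
  apply: (@le_trans _ _ (expR (- L%:R) * \sum_(t <- s) expR (- (2 * t / (2 * k)%:R)))).
    rewrite mulr_sumr [leRHS](bigID (fun t => t <= L%:R * k%:R)) /=.
    apply: ler_wpDl.
      by apply: sumr_ge0 => t _; rewrite mulr_ge0 ?expR_ge0.
    (* For [t > L k], one half of the exponent [2 t / k] gives the factor [exp (- L)], the other
       half is the exponent for [2 k]. *)
    apply: ler_sum => t; rewrite -ltNge => tL; rewrite -expRD ler_expR.
    have -> : 2 * t / (2 * k)%:R = t / k%:R.
      by rewrite natrM; field; rewrite lt0r_neq0.
    have : L%:R <= t / k%:R by rewrite ler_pdivlMr // ltW.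
    by rewrite -mulrA; lra.
  have k20 : (0 < 2 * k)%N by rewrite muln_gt0.
  apply: le_trans (ler_wpM2l (expR_ge0 _) (upper _ s k20 us sT)) _.
  have -> : expR (- L%:R) * (b * (2 * k)%:R) = expR (- L%:R) * (2 * b) * k%:R.
    by rewrite natrM; ring.
  by apply: ler_wpM2r.
have cnt : (counting_function T (L%:R * k%:R))%:R <= (counting_function T r)%:R :> R.
  by rewrite ler_nat; exact: counting_le.
apply: le_trans cnt; have : a / 2 * k%:R <= (counting_function T (L%:R * k%:R))%:R by lra.
apply: le_trans; rewrite mulrAC ler_pdivrMr ?mulr_gt0 //.
have : r <= k.+1%:R * L%:R by rewrite -ler_pdivrMr // ltW.
have := ler_wpM2r (ltW L0) kk => h1 h2.
have := ler_wpM2l (ltW a0) (le_trans h2 h1); lra.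
Qed.

Definition test_eigenvalue (n : nat) : R := if n is n'.+1 then expR (- (n'.+1%:R)^-1) else 0.

Lemma test_eigenvalue01 : unit_weight test_eigenvalue.
Proof.
case=> [|n] /=; first by rewrite lexx ler01.
by rewrite expR_ge0 /= -[leRHS]expR0 ler_expR oppr_le0 invr_ge0 ler0n.
Qed.

(** For [k >= 1] and [n > k] the exponent [2 n / k] exceeds [2], and [exp x >= 1 + x] suffices. For
    [k = 0] the strict inequality excludes the exponent [0]. *)
Lemma test_eigenvalue_half k n : (k < n)%N -> test_eigenvalue k ^+ (2 * n) <= 2^-1.
Proof.
case: k => [|k] kn /=.
  by rewrite expr0n; case: n kn => //= n _; rewrite invr_ge0.
rewrite -expRM_natl mulrN expRN lef_pV2 ?posrE ?expR_gt0 //.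
apply: le_trans (expR_ge1Dx _); rewrite natrM.
have : 1 <= n%:R / k.+1%:R :> R by rewrite ler_pdivlMr ?ltr0n // mul1r ler_nat ltnW.
by rewrite -[2 * _ / _]mulrA; move: (n%:R / k.+1%:R) => x; lra.
Qed.

Lemma linear_growth_of_U_com : U_com T -> T 0 /\ linear_growth T.
Proof.
case=> _ _ uT; have lam01 := test_eigenvalue01.
pose A := l2_diag lam01; pose C := l2_diag (colam01 test_eigenvalue).
have Ab : bounded_op A := l2_diag_bounded _.
have Ap : positive_op A := l2_diag_positive _.
have [a [b [a0 ab ob]]] := uT _ _ A C (@l2_separable R) (@l2_separable R) Ab Ap
  (l2_diag_bounded _) (@diag_pair_commute R _ lam01)
  (@diag_pair_observable R _ lam01 test_eigenvalue_half).
have b0 : 0 < b := lt_le_trans a0 ab.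
have term k t : T t -> hnorm (C (op_power A t (l2_basis k))) ^+ 2 =
    (1 - test_eigenvalue k ^+ 2) * (test_eigenvalue k `^ t) ^+ 2.
  move=> /T_ge0 t0.
  rewrite (op_power_eigenvector Ab Ap (mu := test_eigenvalue k) t0); last exact: l2_diag_basis.
  rewrite /C (linear_mapZ (@l2_diag_linear R _ (colam01 test_eigenvalue))) l2_diag_basis.
  rewrite !hnormZ !normc_real l2_basis_norm mulr1.
  by rewrite exprMn !real_normK ?num_real // (@sqr_colam R _ lam01) mulrC.
have up k (s : seq R) : uniq s -> (forall t, t \in s -> T t) ->
    (1 - test_eigenvalue k ^+ 2) * \sum_(t <- s) (test_eigenvalue k `^ t) ^+ 2 <= b.
  move=> us sT; have /andP[_] := ob (l2_basis k).
  rewrite l2_basis_norm expr1n mulr1 -lee_fin; apply: le_trans.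
  apply: le_trans (sum_le_esum (fun t => hnorm (C (op_power A t (l2_basis k))) ^+ 2) us sT).
  rewrite lee_fin mulr_sumr le_eqVlt; apply/orP; left; apply/eqP.
  by rewrite big_seq [RHS]big_seq; apply: eq_bigr => t /sT Tt; rewrite term.
have low k B : (forall s : seq R, uniq s -> (forall t, t \in s -> T t) ->
    (1 - test_eigenvalue k ^+ 2) * \sum_(t <- s) (test_eigenvalue k `^ t) ^+ 2 <= B) -> a <= B.
  move=> h; have /andP[+ _] := ob (l2_basis k).
  rewrite l2_basis_norm expr1n mulr1 -lee_fin => /le_trans; apply.
  apply: esum_le_of_sum_le => s us sT; apply: le_trans (h s us sT).
  rewrite mulr_sumr le_eqVlt; apply/orP; left; apply/eqP.
  by rewrite big_seq [RHS]big_seq; apply: eq_bigr => t /sT Tt; rewrite term.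
split.
  (* Without [0] in [T], all powers of the eigenvalue [0] vanish, so the zeroth basis vector is
     never observed. *)
  apply: contrapT => nT0; suff : a <= 0 by rewrite leNgt a0.
  apply: (low 0%N) => s us sT; rewrite big_seq big1 ?mulr0 // => t ts /=.
  rewrite powR0 ?expr0n //; apply: contraPneq (sT t ts) => ->; exact: nT0.
have powE k t : (0 < k)%N -> (test_eigenvalue k `^ t) ^+ 2 = expR (- (2 * t / k%:R)).
  case: k => // k _; rewrite /= -powR_mulrn ?powR_ge0 // -powRrM.
  rewrite /powR gt_eqF ?expR_gt0 // expRK; congr expR.
  by move: (k.+1%:R^-1) => x; ring.
have gapE k : (0 < k)%N -> test_eigenvalue k ^+ 2 = expR (- (2 / k%:R)).
  by move=> k0; rewrite -[2 in RHS]mulr1 -powE // powRr1 //; have /andP[] := lam01 k.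
have gap_le k : (0 < k)%N -> 1 - test_eigenvalue k ^+ 2 <= 2 / k%:R.
  by move=> k0; rewrite gapE //; have := expR_ge1Dx (- (2 / k%:R) : R); lra.
(* [exp x >= 1 + x] bounds the gap below by [2 / (k + 2)], and [k + 2 <= 3 k]. *)
have gap_ge k : (0 < k)%N -> 2 / 3 / k%:R <= 1 - test_eigenvalue k ^+ 2.
  move=> k0; rewrite gapE // expRN; have k0R : 0 < k%:R :> R by rewrite ltr0n.
  have k1 : 1 <= k%:R :> R by rewrite ler1n.
  have h : 1 + 2 / k%:R <= expR (2 / k%:R) :> R by exact: expR_ge1Dx.
  have p0 : 0 < 1 + 2 / k%:R :> R by rewrite addr_gt0 // divr_gt0.
  have h' : (expR (2 / k%:R))^-1 <= (1 + 2 / k%:R)^-1 :> R.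
    by rewrite lef_pV2 ?posrE ?expR_gt0.
  suff : 2 / 3 / k%:R <= 1 - (1 + 2 / k%:R)^-1 :> R by lra.
  have -> : 1 - (1 + 2 / k%:R)^-1 = 2 / (k%:R + 2) :> R.
    by field; rewrite ?lt0r_neq0 // addr_gt0.
  by rewrite -mulrA ler_pM2l // -invfM lef_pV2 ?posrE ?mulr_gt0 ?addr_gt0 //; lra.
(* These constants come from dividing by the gap, which lies between [2 / (3 k)] and [2 / k]. *)
apply: (@linear_growth_of_exp_sums (a / 2) (3 / 2 * b)); rewrite ?divr_gt0 ?mulr_gt0 //.
- move=> k s k0 us sT; have k0R : 0 < k%:R :> R by rewrite ltr0n.
  have := up k s us sT; under eq_bigr do rewrite powE //.
  set S := \sum_(t <- s) _ => h; have S0 : 0 <= S.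
    by apply: sumr_ge0 => t _; exact: expR_ge0.
  have := le_trans (ler_wpM2r S0 (gap_ge k k0)) h.
  by rewrite mulrAC ler_pdivrMr //; lra.
- move=> k B k0 h; have k0R : 0 < k%:R :> R by rewrite ltr0n.
  suff : a <= 2 / k%:R * B by rewrite mulrAC ler_pdivlMr //; lra.
  apply: (low k) => s us sT; under eq_bigr do rewrite powE //.
  have S0 : 0 <= \sum_(t <- s) expR (- (2 * t / k%:R)) :> R.
    by apply: sumr_ge0 => t _; exact: expR_ge0.
  apply: le_trans (ler_wpM2r S0 (gap_le k k0)) _.
  by apply: ler_wpM2l; [rewrite divr_ge0|exact: h].
Qed.

End Necessity.

Theorem theorem3p3 (R : realType) (T : set R) :
  T `<=` `[0, +oo[ -> locally_finite T ->
  (U_com T <-> T 0 /\ linear_growth T).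
Proof.
move=> T0 Tlf; split; first exact: linear_growth_of_U_com.
move=> [T00 Tg]; split=> // H Y A C _ _ Ab Ap Cb comm ob.
exact: exactly_observable_of_linear_growth.
Qed.
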